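(* Let $\mathbb F_\infty$ be the free group on countably infinitely many generators. There exist topologically free minimal actions of $\mathbb F_\infty$ on the Cantor space without dynamical comparison. Moreover, these actions can be chosen to be either Bernoulli-measure-preserving, or without any invariant probability measure. That is: (1) there exists a topologically free minimal action of $\mathbb F_\infty$ by homeomorphisms on the Cantor space $\{0,1\}^{\mathbb N}$ that preserves the Bernoulli $(\tfrac12,\tfrac12)$-measure and does not have dynamical comparison; and (2) there exists a topologically free minimal action of $\mathbb F_\infty$ by homeomorphisms on the Cantor space that admits no invariant Borel probability measure and does not have dynamical comparison.
   Context: Let a discrete group $G$ act by homeomorphisms on a compact Hausdorff space $X$. The action is minimal if every orbit is dense. It is topologically free if for every $g\in G\setminus\{e\}$ the set $\{x\in X: gx=x\}$ has empty interior. $M_G(X)$ denotes the set of $G$-invariant regular Borel probability measures on $X$ (regularity is automatic if $X$ is metrisable). For open $U,V\subseteq X$ write $U\preccurlyeq V$ ($U$ is dynamically subequivalent to $V$) if for every compact $K\subseteq U$ there exist $n\ge 1$, open sets $W_1,\dots,W_n\subseteq X$ and $g_1,\dots,g_n\in G$ such that $K\subseteq W_1\cup\dots\cup W_n$ and the sets $g_1W_1,\dots,g_nW_n$ are pairwise disjoint and contained in $V$. A minimal action $G\curvearrowright X$ has dynamical comparison if whenever $U,V$ are nonempty open sets with $\mu(U)<\mu(V)$ for every $\mu\in M_G(X)$, then $U\preccurlyeq V$. (If $M_G(X)=\emptyset$, the condition on measures is vacuously satisfied.) The Bernoulli $(\tfrac12,\tfrac12)$-measure on $\{0,1\}^{\mathbb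 N}$ is the product measure obtained by assigning probability $\tfrac12$ to both $0$ and $1$ in each coordinate. *)

(* Defs.v *)
From HB Require Import structures.
From mathcomp Require Import all_boot all_order all_algebra.
From mathcomp Require Import all_classical all_reals all_analysis.

Set Implicit Arguments.
Unset Strict Implicit.
Unset Printing Implicit Defensive.

Import Order.TTheory GRing.Theory Num.Theory.
Local Open Scope classical_set_scope.

(** * The free group on a set of generators *)

(* A letter (i, true) is the generator i, and (i, false) is its formal inverse.
   Elements of the free group are the reduced words, and the product of two
   reduced words is the reduced form of their concatenation. *)
Section FreeGroup.
Variable I : choiceType.

Definition letter : Type := (I * bool)%type.

Definition letter_inv (a : letter) : letter := (a.1, ~~ a.2).

Definition reduced (w : seq (I * bool)) : bool :=
  sorted (fun a b => b != letter_inv a) w.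

(* Left multiplication of a reduced word by one letter. *)
Definition push (a : I * bool) (w : seq (I * bool)) : seq (I * bool) :=
  if w is b :: w' then if b == letter_inv a then w' else a :: w else [:: a].

Lemma letter_invK : involutive letter_inv.
Proof. by case=> i b; rewrite /letter_inv /= negbK. Qed.

Lemma reduced_behead a w : reduced (a :: w) -> reduced w.
Proof. exact: path_sorted. Qed.

Lemma push_reduced a w : reduced w -> reduced (push a w).
Proof.
case: w => [|b w] //= rw; case: ifPn => [_|ba]; first exact: reduced_behead rw.
by rewrite /= ba.
Qed.

Lemma foldr_push_reduced u w : reduced w -> reduced (foldr push w u).
Proof. by move=> rw; elim: u => //= a u; exact: push_reduced. Qed.

Lemma push_invK a w : reduced w -> push (letter_inv a) (push a w) = w.
Proof.
case: w => [|b w] /= rw; first by rewrite letter_invK eqxx.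
case: ifPn => [/eqP ba|ba] /=; last by rewrite letter_invK eqxx.
move: rw; rewrite ba; case: w => [|c w] //= /andP[ca _].
by rewrite (negPf ca).
Qed.

Lemma push_Kinv a w : reduced w -> push a (push (letter_inv a) w) = w.
Proof. by move=> rw; rewrite -{1}[a]letter_invK push_invK. Qed.

Lemma foldr_push_push a v w : reduced w ->
  foldr push w (push a v) = push a (foldr push w v).
Proof.
case: v => [|b v] //= rw; case: ifPn => //= /eqP ->.
by rewrite push_Kinv// foldr_push_reduced.
Qed.

Lemma push_reducedE a w : reduced (a :: w) -> push a w = a :: w.
Proof. by case: w => [|b w] //= /andP[/negPf -> _]. Qed.

Lemma foldr_push0 w : reduced w -> foldr push [::] w = w.
Proof.
elim: w => [//|a w IHw] raw; rewrite /= (IHw (reduced_behead raw)).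
exact: push_reducedE.
Qed.

Definition word_inv (w : seq (I * bool)) : seq (I * bool) :=
  rev (map letter_inv w).

Lemma word_invK : involutive word_inv.
Proof.
by move=> w; rewrite /word_inv map_rev revK -map_comp map_id_in// => a _ /=;
  exact: letter_invK.
Qed.

Lemma word_inv_reduced w : reduced w -> reduced (word_inv w).
Proof.
rewrite /reduced /word_inv rev_sorted sorted_map; apply: sub_sorted => a b /=.
by apply: contra => /eqP ->; rewrite letter_invK.
Qed.

Lemma word_mulVw w : reduced w -> foldr push w (word_inv w) = [::].
Proof.
elim: w => //= a w IHw raw; rewrite /word_inv /= rev_cons -cats1 foldr_cat /=.
by rewrite letter_invK eqxx IHw// (reduced_behead raw).
Qed.

Record free_group := FreeGroup {
  free_word :> seq (I * bool);
  _ : reduced free_word }.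

HB.instance Definition _ := [isSub of free_group for free_word].
HB.instance Definition _ := [Equality of free_group by <:].
HB.instance Definition _ := [Choice of free_group by <:].

Implicit Types u v w : free_group.

Definition free_one : free_group := @FreeGroup [::] erefl.
Definition free_mul u v : free_group :=
  FreeGroup (foldr_push_reduced u (valP v)).
Definition free_inv u : free_group := FreeGroup (word_inv_reduced (valP u)).

Lemma free_mulA : associative free_mul.
Proof.
move=> [u ru] [v rv] [w rw]; apply: val_inj => /=.
elim: u {ru} => //= a u ->.
by rewrite foldr_push_push.
Qed.

Lemma free_mul1 : left_id free_one free_mul.
Proof. by move=> u; exact: val_inj. Qed.

Lemma free_mul_1 : right_id free_one free_mul.
Proof. by case=> u ru; apply: val_inj; exact: foldr_push0. Qed.

Lemma free_mulV : left_inverse free_one free_inv free_mul.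
Proof. by case=> u ru; apply: val_inj; exact: word_mulVw. Qed.

Lemma free_mul_V : right_inverse free_one free_inv free_mul.
Proof.
case=> u ru; apply: val_inj => /=.
by have := word_mulVw (word_inv_reduced ru); rewrite word_invK.
Qed.

HB.instance Definition _ := isGroup.Build free_group
  free_mulA free_mul1 free_mul_1 free_mulV free_mul_V.

Definition free_gen (i : I) : free_group := @FreeGroup [:: (i, true)] erefl.

(* The universal property. *)
Local Open Scope group_scope.

Definition free_lift (H : groupType) (f : I -> H) u : H :=
  foldr (fun a h => (if a.2 then f a.1 else (f a.1)^-1) * h) 1 (free_word u).

Lemma free_lift_gen (H : groupType) (f : I -> H) i :
  free_lift f (free_gen i) = f i.
Proof. by rewrite /free_lift /= mulg1. Qed.

Lemma free_liftM (H : groupType) (f : I -> H) :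
  {morph free_lift f : u v / u * v}.
Proof.
move=> [u ru] [v rv]; rewrite /free_lift /=.
set F := fun a h => _; elim: u {ru} => [|a u IHu] /=; first by rewrite mul1g.
have Fpush b x : foldr F 1 (push b x) = F b (foldr F 1 x).
  case: x => [|c x] //=; case: ifPn => //= /eqP ->.
  by case: b => i []; rewrite /F /= ?mulVKg ?mulKg.
by rewrite Fpush IHu /F mulgA.
Qed.

Lemma free_lift_unique (H : groupType) (f : I -> H) (p : free_group -> H) :
  {morph p : u v / u * v} -> (forall i, p (free_gen i) = f i) ->
  p =1 free_lift f.
Proof.
move=> pM pf.
have p1 : p 1 = 1 by apply: (@mulgI _ (p 1)); rewrite -pM !mulg1.
have pV u : p u^-1 = (p u)^-1.
  by apply: (@mulgI _ (p u)); rewrite -pM !mulgV p1.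
case=> u ru; rewrite /free_lift /=; elim: u ru => [|a u IHu] rau /=.
  by rewrite -p1; congr (p _); exact: val_inj.
rewrite -(IHu (reduced_behead rau)) -pf.
have -> : (if a.2 then p (free_gen a.1) else (p (free_gen a.1))^-1) =
          p (@FreeGroup [:: a] erefl).
  case: a {rau} => i [] /=; first by congr (p _); exact: val_inj.
  by rewrite -pV; congr (p _); exact: val_inj.
by rewrite -pM; congr (p _); apply: val_inj; rewrite /= push_reducedE.
Qed.

End FreeGroup.

Definition F_infty : groupType := free_group nat.

(** * Dynamics of discrete groups *)

Section Dynamics.
Variables (G : groupType) (X : ptopologicalType) (a : G -> X -> X).

(* Each [a g] is then a homeomorphism, with continuous inverse [a g^-1]. *)
Definition acts_by_homeomorphisms : Prop :=
  [/\ forall x, a 1%g x = x,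
      forall g h x, a (g * h)%g x = a g (a h x) &
      forall g, continuous (a g)].

Definition minimal_action : Prop :=
  forall x, dense (range (fun g => a g x)).

Definition topologically_free : Prop :=
  forall g, g <> 1%g -> interior [set x | a g x = x] = set0.

Definition dyn_subequivalent (U V : set X) : Prop :=
  forall K : set X, compact K -> K `<=` U ->
  exists (n : nat) (W : 'I_n -> set X) (g : 'I_n -> G),
    [/\ (1 <= n)%N,
        forall i, open (W i),
        K `<=` \bigcup_i W i,
        forall i j, i != j -> (a (g i) @` W i) `&` (a (g j) @` W j) = set0 &
        forall i, a (g i) @` W i `<=` V].

End Dynamics.

Definition borel (X : ptopologicalType) := g_sigma_algebraType (@open X).

Section InvariantMeasures.
Variables (R : realType) (G : groupType) (X : ptopologicalType).
Variable a : G -> X -> X.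

Definition regular_measure (mu : probability (borel X) R) : Prop :=
  forall A : set (borel X), measurable A ->
    mu A = ereal_inf [set mu U | U in [set U : set X | open U /\ A `<=` U]] /\
    mu A = ereal_sup [set mu K | K in [set K : set X | compact K /\ K `<=` A]].

Definition invariant_measure (mu : probability (borel X) R) : Prop :=
  forall (g : G) (A : set (borel X)), measurable A -> mu (a g @^-1` A) = mu A.

(* The set M_G(X). *)
Definition invariant_measures : set (probability (borel X) R) :=
  [set mu | regular_measure mu /\ invariant_measure mu].

Definition dynamical_comparison : Prop :=
  forall U V : set X, open U -> open V -> U !=set0 -> V !=set0 ->
    (forall mu, invariant_measures mu -> (mu U < mu V)%E) ->
    dyn_subequivalent a U V.

End InvariantMeasures.

(* [mu] is the infinite product of copies of the uniform measure on {0, 1};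
   boxes with finitely many constrained coordinates are a pi-system generating
   the Borel sets, so [mu] is uniquely determined. *)
Definition is_bernoulli_half (R : realType)
    (mu : probability (borel cantor_space) R) : Prop :=
  forall (n : nat) (A : nat -> set bool),
    mu [set x : cantor_space | forall i, (i < n)%N -> A i (x i)] =
    (\prod_(i < n) bernoulli_prob (2^-1 : R)%R (A i))%E.

(* Main.v *)
Require Import Defs.
From mathcomp Require Import all_boot all_order all_algebra.
From mathcomp Require Import all_classical all_reals all_analysis.
From HB Require Import structures.
From mathcomp Require Import measurable_realfun.
From mathcomp Require Import zify ring lra.

(** A stage records, for finitely many generators, two partitions of the Cantor
    space into clopen faces of the same shape: a generator is only known to map
    the face [src j = e] onto the face [tgt j = e]. Starting from the indicator of
    a clopen set [V], one may replace faces by their images as long as the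
    resulting integer-valued function stays nonnegative; if this never dominates
    the indicator of [U], then [U] is not subequivalent to [V] for reasons visible
    at this stage. A stage is refined by letting every cell see the cells of all its
    neighbours, in all possible combinations: replacing a function on the new
    faces by its maxmin value on each old face shows that nothing new becomes
    reachable. A sequence of such refinements determines homeomorphisms. As only
    boundedly many copies of a small cell [W] can be reached from [V], new
    generators can be added between refinements that move every point into [W]
    but presuppose more copies of [W] than are available; this makes the limit
    action minimal. It is topologically free since reduced words follow
    unconstrained chains of cells.

    The first action starts from a 3 x 2 table, so that twice a column equals three
    times a row although a column does not dominate a row; the second one from
    a set [V] such that both three and four times [V] make up the whole space. *)
Set Implicit Arguments.
Unset Strict Implicit.
Unset Printing Implicit Defensive.

Import Order.TTheory GRing.Theory Num.Theory.
Local Open Scope classical_set_scope.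
Local Open Scope ring_scope.

(** * Stages and their refinement by neighbourhoods *)

Definition point := nat -> bool.
(* In a refined stage, the label of a face of a generator consists of the words of
   the source cell and of the target cell. *)
Definition label := (seq bool * seq bool)%type.

Definition agree (n : nat) (x y : point) : Prop := forall i, (i < n)%N -> x i = y i.

Lemma agree_sym n x y : agree n x y -> agree n y x.
Proof. by move=> xy i /xy. Qed.

Lemma agree_trans n y x z : agree n x y -> agree n y z -> agree n x z.
Proof. by move=> xy yz i lin; rewrite xy ?yz. Qed.

Lemma agree_le m n x y : (m <= n)%N -> agree n x y -> agree m x y.
Proof. by move=> mn xy i im; apply: xy; exact: leq_trans im mn. Qed.

Lemma agreeP n x y : agree n x y <-> mkseq x n = mkseq y n.
Proof.
split=> [xy|xy i lin]; last by rewrite -(nth_mkseq false x lin) xy nth_mkseq.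
by apply/eq_in_map => i; rewrite mem_iota => /andP[_ /xy].
Qed.

Record stage := Stage {
  gens : nat;
  depth : nat;
  src : nat -> point -> label;
  tgt : nat -> point -> label;
  fwd : nat -> point -> point;
  bwd : nat -> point -> point }.

(** [fwd] and [bwd] only witness that a label occurs on the source side exactly when it occurs on
    the target side; they need not be mutually inverse. *)
Record stage_ok (D : stage) : Prop := StageOk {
  depth_gt0 : (0 < depth D)%N;
  src_agree : forall j, (j < gens D)%N -> forall x y,
    agree (depth D) x y -> src D j x = src D j y;
  tgt_agree : forall j, (j < gens D)%N -> forall x y,
    agree (depth D) x y -> tgt D j x = tgt D j y;
  fwd_agree : forall j, (j < gens D)%N -> forall x y,
    agree (depth D) x y -> agree (depth D) (fwd D j x) (fwd D j y);
  bwd_agree : forall j, (j < gens D)%N -> forall x y,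
    agree (depth D) x y -> agree (depth D) (bwd D j x) (bwd D j y);
  src_fwd : forall j, (j < gens D)%N -> forall x, src D j x = tgt D j (fwd D j x);
  src_bwd : forall j, (j < gens D)%N -> forall x, src D j (bwd D j x) = tgt D j x }.

(* On words of length [depth D], [fwd D j] is then a bijection taking source faces
   to target faces, so that these have the same Bernoulli measure. *)
Definition balanced (D : stage) : Prop := forall j, (j < gens D)%N -> forall x,
  agree (depth D) (bwd D j (fwd D j x)) x /\
  agree (depth D) (fwd D j (bwd D j x)) x.

(* One move replaces the faces with label in [S] by their images; the complement
   of [S] gives the inverse move. *)
Inductive reach (D : stage) (V : point -> int) : (point -> int) -> Prop :=
| reach0 y : (forall x, y x = V x) -> reach D V y
| reachS y y' j (S : label -> bool) : reach D V y -> (j < gens D)%N ->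
    (forall x, y' x = y x + (S (src D j x))%:Z - (S (tgt D j x))%:Z) ->
    (forall x, 0 <= y' x) -> reach D V y'.

Definition bounded_reach D V (K : nat) := forall y, reach D V y -> forall x, y x <= K%:Z.

(** The uniform bound is what later allows attracting generators to be added. *)
Definition good D (U V : point -> int) : Prop :=
  (forall y, reach D V y -> exists x, y x < U x) /\
  exists K, bounded_reach D V K.

(** * Refining a stage by the cells of all neighbours *)

Section Ball.
Variables (D : stage) (okD : stage_ok D).
Let J := gens D.
Let L := depth D.
Let L_gt0 : (0 < L)%N := depth_gt0 okD.

Definition slot k (x : point) : point := fun t => x (k.+1 * L + t)%N.

(** One head block, two neighbour slots for each generator, and a last bit that no label reads. That
    bit later separates points with equal labels. *)
Definition ball_depth := (J.*2.+1 * L).+1.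

(** An even slot proposes the cell of the image. A proposal in the wrong target face is rejected in
    favour of the default [fwd]. Odd slots serve preimages in the same way. *)
Definition next j x :=
  if src D j x == tgt D j (slot j.*2 x) then slot j.*2 x else fwd D j x.

Definition prev j x :=
  if src D j (slot j.*2.+1 x) == tgt D j x then slot j.*2.+1 x else bwd D j x.

Definition assemble (p q : point) (a b : nat -> point) : point := fun t =>
  if (t < L)%N then p t else
  if (t < J.*2.+1 * L)%N then
    (if odd (t %/ L).-1 then b else a) ((t %/ L).-1)./2 (t %% L)%N
  else q t.

Lemma assemble_head p q a b : agree L (assemble p q a b) p.
Proof. by move=> i iL; rewrite /assemble iL. Qed.

Lemma slot_assemble p q a b k : (k < J.*2)%N ->
  agree L (slot k (assemble p q a b)) ((if odd k then b else a) k./2).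
Proof.
move=> kJ i iL; rewrite /slot /assemble.
have -> : (k.+1 * L + i < L)%N = false by apply/negbTE; rewrite -leqNgt; nia.
have -> : (k.+1 * L + i < J.*2.+1 * L)%N by nia.
by rewrite divnMDl// divn_small// addn0 modnMDl modn_small//; case: odd.
Qed.

Lemma slot_assembleE p q a b j : (j < J)%N ->
  agree L (slot j.*2 (assemble p q a b)) (a j) /\
  agree L (slot j.*2.+1 (assemble p q a b)) (b j).
Proof.
move=> jJ; split.
  have := @slot_assemble p q a b j.*2; rewrite odd_double doubleK; apply; lia.
have := @slot_assemble p q a b j.*2.+1.
by rewrite /= odd_double /= uphalf_double; apply; lia.
Qed.

Lemma assemble_tail p q a b : assemble p q a b (J.*2.+1 * L)%N = q (J.*2.+1 * L)%N.
Proof.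
by rewrite /assemble ltnn; case: ifP => //; rewrite ltnNge leq_pmull.
Qed.

Lemma slot_agree k x y : (k < J.*2)%N -> agree ball_depth x y ->
  agree L (slot k x) (slot k y).
Proof. by move=> kJ xy i iL; apply: xy; rewrite /ball_depth; nia. Qed.

Lemma ball_depth_gt : (L < ball_depth)%N.
Proof. by rewrite /ball_depth; nia. Qed.

Lemma head_agree x y : agree ball_depth x y -> agree L x y.
Proof. exact/agree_le/ltnW/ball_depth_gt. Qed.

Lemma ball_agree x y : agree L x y ->
  (forall j, (j < J)%N -> agree L (slot j.*2 x) (slot j.*2 y) /\
                          agree L (slot j.*2.+1 x) (slot j.*2.+1 y)) ->
  x (J.*2.+1 * L)%N = y (J.*2.+1 * L)%N -> agree ball_depth x y.
Proof.
move=> xy sxy txy t; rewrite /ball_depth ltnS leq_eqVlt => /orP[/eqP -> //|tJ].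
have [/xy//|Lt] := ltnP t L.
have qE : (t %/ L < J.*2.+1)%N by rewrite ltn_divLR.
have q0 : (0 < t %/ L)%N by rewrite divn_gt0.
have tE := divn_eq t L; have mL : (t %% L < L)%N by rewrite ltn_mod.
have jJ : ((t %/ L).-1./2 < J)%N by lia.
have [/(_ _ mL) s0 /(_ _ mL) s1] := sxy _ jJ.
move: s0 s1; rewrite /slot; case/boolP: (odd (t %/ L).-1) => oq.
  have -> : ((t %/ L).-1./2.*2.+2 * L + t %% L = t)%N.
    rewrite [RHS]tE; congr (_ * _ + _)%N.
    by have := odd_double_half (t %/ L).-1; rewrite oq; lia.
  by [].
have -> : ((t %/ L).-1./2.*2.+1 * L + t %% L = t)%N.
  rewrite [RHS]tE; congr (_ * _ + _)%N.
  by have := odd_double_half (t %/ L).-1; rewrite (negbTE oq); lia.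
by [].
Qed.

Lemma next_agree j x y : (j < J)%N -> agree ball_depth x y ->
  agree L (next j x) (next j y).
Proof.
move=> jJ xy; have hxy := head_agree xy.
have sxy : agree L (slot j.*2 x) (slot j.*2 y) by apply: slot_agree; [lia|].
rewrite /next (src_agree okD jJ hxy) (tgt_agree okD jJ sxy).
by case: ifP => // _; exact: fwd_agree.
Qed.

Lemma prev_agree j x y : (j < J)%N -> agree ball_depth x y ->
  agree L (prev j x) (prev j y).
Proof.
move=> jJ xy; have hxy := head_agree xy.
have sxy : agree L (slot j.*2.+1 x) (slot j.*2.+1 y) by apply: slot_agree; [lia|].
rewrite /prev (tgt_agree okD jJ hxy) (src_agree okD jJ sxy).
by case: ifP => // _; exact: bwd_agree.
Qed.

Lemma src_next j x : (j < J)%N -> src D j x = tgt D j (next j x).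
Proof. by move=> jJ; rewrite /next; case: eqP => // _; exact: src_fwd. Qed.

Lemma src_prev j x : (j < J)%N -> src D j (prev j x) = tgt D j x.
Proof. by move=> jJ; rewrite /prev; case: eqP => // _; exact: src_bwd. Qed.

(** Compatible proposals are never rejected, so neighbours for all generators can be prescribed at
    once. *)
Lemma ball_rich (p q : point) (a b : nat -> point) :
  (forall j, (j < J)%N -> src D j p = tgt D j (a j) /\ src D j (b j) = tgt D j p) ->
  exists p', [/\ agree L p' p, p' (J.*2.+1 * L)%N = q (J.*2.+1 * L)%N &
   forall j, (j < J)%N -> agree L (next j p') (a j) /\ agree L (prev j p') (b j)].
Proof.
move=> ab; exists (assemble p q a b); split.
- exact: assemble_head.
- exact: assemble_tail.
move=> j jJ; have [sa sb] := slot_assembleE p q a b jJ; have [pa bp] := ab j jJ.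
have hp := @assemble_head p q a b.
rewrite /next /prev (src_agree okD jJ hp) (tgt_agree okD jJ hp).
by rewrite (tgt_agree okD jJ sa) (src_agree okD jJ sb) pa bp !eqxx.
Qed.

Definition ball_src j x : label := (mkseq x L, mkseq (next j x) L).
Definition ball_tgt j x : label := (mkseq (prev j x) L, mkseq x L).

(* [v] is the value of the game on the face [e] of the generator [j], where the
   choice of a source cell maximizes and that of a target cell minimizes [f]. *)
Definition face_value (f : label -> int) j e (v : int) : Prop :=
  (forall x, src D j x = e ->
     exists z, tgt D j z = e /\ f (mkseq x L, mkseq z L) <= v) /\
  (exists x, src D j x = e /\
     forall z, tgt D j z = e -> v <= f (mkseq x L, mkseq z L)).

Definition swap_slots j (x p : point) (a b : point) : point :=
  assemble p x (fun i => if i == j then a else slot i.*2 x)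
               (fun i => if i == j then b else slot i.*2.+1 x).

(* In the balanced case, [ball_fwd j] and [ball_bwd j] are made mutually inverse
   by exchanging the roles of the two slots of the generator [j]. *)
Definition ball_fwd j x : point :=
  let c := if src D j x == tgt D j (slot j.*2 x) then x
           else if `[< balanced D >] then bwd D j (slot j.*2 x) else x in
  swap_slots j x (next j x) (slot j.*2.+1 x) c.

Definition ball_bwd j x : point :=
  let c := if src D j (slot j.*2.+1 x) == tgt D j x then x
           else if `[< balanced D >] then fwd D j (slot j.*2.+1 x) else x in
  swap_slots j x (prev j x) c (slot j.*2 x).

Lemma swap_slotsP j x p a b : (j < J)%N -> let y := swap_slots j x p a b in
  [/\ agree L y p, agree L (slot j.*2 y) a, agree L (slot j.*2.+1 y) b,
     y (J.*2.+1 * L)%N = x (J.*2.+1 * L)%N &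
     forall i, (i < J)%N -> i != j -> agree L (slot i.*2 y) (slot i.*2 x) /\
        agree L (slot i.*2.+1 y) (slot i.*2.+1 x)].
Proof.
move=> jJ /=; rewrite /swap_slots; set a' := fun i => _; set b' := fun i => _.
have [s0 s1] := slot_assembleE p x a' b' jJ.
split; first exact: assemble_head.
- by move: s0; rewrite {2}/a' eqxx.
- by move: s1; rewrite {2}/b' eqxx.
- exact: assemble_tail.
- move=> i iJ ij; have [] := slot_assembleE p x a' b' iJ.
  by rewrite {2}/a' {3}/b' (negbTE ij).
Qed.

Lemma swap_slots_agree j x x' p p' a a' b b' : (j < J)%N ->
  agree ball_depth x x' -> agree L p p' -> agree L a a' -> agree L b b' ->
  agree ball_depth (swap_slots j x p a b) (swap_slots j x' p' a' b').
Proof.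
move=> jJ xx pp aa bb.
have [h s0 s1 t si] := @swap_slotsP j x p a b jJ.
have [h' s0' s1' t' si'] := @swap_slotsP j x' p' a' b' jJ.
apply: ball_agree.
- exact: agree_trans h (agree_trans pp (agree_sym h')).
- move=> i iJ; have [->|ij] := eqVneq i j.
    by split; [apply: agree_trans s0 (agree_trans aa (agree_sym s0'))|
               apply: agree_trans s1 (agree_trans bb (agree_sym s1'))].
  have [e0 e1] := si i iJ ij; have [e0' e1'] := si' i iJ ij.
  split; [apply: agree_trans e0 (agree_trans _ (agree_sym e0'))|
          apply: agree_trans e1 (agree_trans _ (agree_sym e1'))];
  apply: slot_agree => //; lia.
- by rewrite t t'; apply: xx; rewrite /ball_depth.
Qed.

Lemma ball_fwd_compat j x : (j < J)%N -> ball_src j x = ball_tgt j (ball_fwd j x).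
Proof.
move=> jJ; rewrite /ball_src /ball_tgt; set y := ball_fwd j x.
have := @swap_slotsP j x (next j x) (slot j.*2.+1 x)
  (if src D j x == tgt D j (slot j.*2 x) then x
   else if `[< balanced D >] then bwd D j (slot j.*2 x) else x) jJ.
rewrite -/(ball_fwd j x) -/y => -[h _ s _ _].
congr pair; apply/agreeP; last exact: agree_sym.
have ty : tgt D j y = src D j x by rewrite (src_next x jJ); exact: tgt_agree.
apply: agree_sym; rewrite /prev (src_agree okD jJ s) ty.
move: s h; rewrite /next; case: eqP => [c s h|nc]; first by rewrite eqxx.
(* In the balanced case the odd slot of the image holds [bwd] of the rejected proposal, whose label
   is again wrong; hence [prev] falls back to [bwd], which undoes [fwd]. *)
case: asboolP => [bal s h|_ s h]; last by rewrite eqxx.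
rewrite (src_bwd okD jJ) eq_sym; case: eqP => // _.
by apply: agree_trans (bwd_agree okD jJ h) _; have [] := bal j jJ x.
Qed.

Lemma ball_bwd_compat j x : (j < J)%N -> ball_src j (ball_bwd j x) = ball_tgt j x.
Proof.
move=> jJ; rewrite /ball_src /ball_tgt; set y := ball_bwd j x.
have := @swap_slotsP j x (prev j x) 
  (if src D j (slot j.*2.+1 x) == tgt D j x then x
   else if `[< balanced D >] then fwd D j (slot j.*2.+1 x) else x) (slot j.*2 x) jJ.
rewrite -/(ball_bwd j x) -/y => -[h s _ _ _].
congr pair; apply/agreeP; first exact: h.
have ty : src D j y = tgt D j x by rewrite -(src_prev x jJ); exact: src_agree.
rewrite /next (tgt_agree okD jJ s) ty.
move: s h; rewrite /prev; case: eqP => [c s h|nc]; first by rewrite eqxx.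
case: asboolP => [bal s h|_ s h]; last by rewrite eqxx.
rewrite -(src_fwd okD jJ) eq_sym; case: eqP => // _.
by apply: agree_trans (fwd_agree okD jJ h) _; have [] := bal j jJ x.
Qed.

Lemma ball_fwd_agree j x y : (j < J)%N -> agree ball_depth x y ->
  agree ball_depth (ball_fwd j x) (ball_fwd j y).
Proof.
move=> jJ xy; have h := head_agree xy.
have s0 : agree L (slot j.*2 x) (slot j.*2 y) by apply: slot_agree => //; lia.
have s1 : agree L (slot j.*2.+1 x) (slot j.*2.+1 y) by apply: slot_agree => //; lia.
apply: swap_slots_agree => //; first exact: next_agree.
rewrite (src_agree okD jJ h) (tgt_agree okD jJ s0).
by do 2 case: ifP => // _; exact: bwd_agree.
Qed.

Lemma ball_bwd_agree j x y : (j < J)%N -> agree ball_depth x y ->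
  agree ball_depth (ball_bwd j x) (ball_bwd j y).
Proof.
move=> jJ xy; have h := head_agree xy.
have s0 : agree L (slot j.*2 x) (slot j.*2 y) by apply: slot_agree => //; lia.
have s1 : agree L (slot j.*2.+1 x) (slot j.*2.+1 y) by apply: slot_agree => //; lia.
apply: swap_slots_agree => //; first exact: prev_agree.
rewrite (src_agree okD jJ s1) (tgt_agree okD jJ h).
by do 2 case: ifP => // _; exact: fwd_agree.
Qed.

(** An accepted proposal becomes the head of the image and a rejected one is stored through [bwd];
    either way the slot can be recovered. *)
Lemma ball_fwdK j x : balanced D -> (j < J)%N ->
  agree ball_depth (ball_bwd j (ball_fwd j x)) x.
Proof.
move=> bal jJ; have [/agreeP hx _] := ball_fwd_compat x jJ.
set y := ball_fwd j x in hx *.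
have := @swap_slotsP j x (next j x) (slot j.*2.+1 x)
  (if src D j x == tgt D j (slot j.*2 x) then x
   else if `[< balanced D >] then bwd D j (slot j.*2 x) else x) jJ.
rewrite -/(ball_fwd j x) -/y => -[hy s0 s1 t si].
have := @swap_slotsP j y (prev j y) 
  (if src D j (slot j.*2.+1 y) == tgt D j y then y
   else if `[< balanced D >] then fwd D j (slot j.*2.+1 y) else y) (slot j.*2 y) jJ.
rewrite -/(ball_bwd j y) => -[hy' s0' s1' t' si'].
have ty : tgt D j y = src D j x by rewrite (src_next x jJ); exact: tgt_agree.
apply: ball_agree; first exact: agree_trans hy' (agree_sym hx).
- move=> i iJ; have [->|ij] := eqVneq i j; last first.
    have [e0 e1] := si i iJ ij; have [e0' e1'] := si' i iJ ij.
    by split; [exact: agree_trans e0' e0|exact: agree_trans e1' e1].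
  split; last exact: agree_trans s1' s0.
  apply: agree_trans s0' _; rewrite (src_agree okD jJ s1) ty.
  move: s1 hy; rewrite /next; case: eqP => [c s1 hy|nc]; first by rewrite eqxx.
  case: asboolP => // _ s1 hy; rewrite (src_bwd okD jJ) eq_sym; case: eqP => // _.
  by apply: agree_trans (fwd_agree okD jJ s1) _; have [] := bal j jJ (slot j.*2 x).
- by rewrite t' t.
Qed.

Lemma ball_bwdK j x : balanced D -> (j < J)%N ->
  agree ball_depth (ball_fwd j (ball_bwd j x)) x.
Proof.
move=> bal jJ; have [_ /agreeP hx] := ball_bwd_compat x jJ.
set y := ball_bwd j x in hx *.
have := @swap_slotsP j x (prev j x) 
  (if src D j (slot j.*2.+1 x) == tgt D j x then x
   else if `[< balanced D >] then fwd D j (slot j.*2.+1 x) else x) (slot j.*2 x) jJ.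
rewrite -/(ball_bwd j x) -/y => -[hy s0 s1 t si].
have := @swap_slotsP j y (next j y) (slot j.*2.+1 y)
  (if src D j y == tgt D j (slot j.*2 y) then y
   else if `[< balanced D >] then bwd D j (slot j.*2 y) else y) jJ.
rewrite -/(ball_fwd j y) => -[hy' s0' s1' t' si'].
have ty : src D j y = tgt D j x by rewrite -(src_prev x jJ); exact: src_agree.
apply: ball_agree; first exact: agree_trans hy' hx.
- move=> i iJ; have [->|ij] := eqVneq i j; last first.
    have [e0 e1] := si i iJ ij; have [e0' e1'] := si' i iJ ij.
    by split; [exact: agree_trans e0' e0|exact: agree_trans e1' e1].
  split; first exact: agree_trans s0' s1.
  apply: agree_trans s1' _; rewrite (tgt_agree okD jJ s0) ty.
  move: s0 hy; rewrite /prev; case: eqP => [c s0 hy|nc]; first by rewrite eqxx.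
  case: asboolP => // _ s0 hy; rewrite -(src_fwd okD jJ) eq_sym; case: eqP => // _.
  by apply: agree_trans (bwd_agree okD jJ s0) _; have [] := bal j jJ (slot j.*2.+1 x).
- by rewrite t' t.
Qed.

Definition ball : stage := Stage J ball_depth ball_src ball_tgt ball_fwd ball_bwd.

Lemma ball_ok : stage_ok ball.
Proof.
split=> //=.
- move=> j jJ x y xy; rewrite /ball_src; congr pair; apply/agreeP.
    exact: head_agree.
  exact: next_agree.
- move=> j jJ x y xy; rewrite /ball_tgt; congr pair; apply/agreeP.
    exact: prev_agree.
  exact: head_agree.
- by move=> j jJ x y; exact: ball_fwd_agree.
- by move=> j jJ x y; exact: ball_bwd_agree.
- by move=> j jJ x; exact: ball_fwd_compat.
- by move=> j jJ x; exact: ball_bwd_compat.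
Qed.

Lemma ball_balanced : balanced D -> balanced ball.
Proof. by move=> bal j jJ x; split; [exact: ball_fwdK|exact: ball_bwdK]. Qed.

(** * Reachability before and after the refinement *)

Let D' := ball.

(** A sequence of moves matters only through its totals: [f j e] counts with sign how often the face
    [e] of the generator [j] has been moved. *)
Definition flow (E : stage) (V : point -> int) (f : nat -> label -> int) x : int :=
  V x + \sum_(j < J) (f j (src E j x) - f j (tgt E j x)).

Definition simulates V (f g : nat -> label -> int) y' : Prop :=
  [/\ forall x, y' x = flow D' V f x, reach D V (flow D V g) &
   forall j, (j < J)%N -> forall x0, face_value (f j) j (src D j x0) (g j (src D j x0))].

(* A point whose neighbours are optimal replies to those of [p]. *)
Lemma simulates_le V f g p :
  (forall x y, agree L x y -> V x = V y) ->
  (forall j, (j < J)%N -> forall x0, face_value (f j) j (src D j x0) (g j (src D j x0))) ->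
  forall (k : option nat) (s : bool) w,
    (forall j, k = Some j -> (j < J)%N /\
       if s then src D j p = tgt D j w else src D j w = tgt D j p) ->
  exists p', agree L p' p /\
   flow D' V f p' <= flow D V g p + 
     if k is Some j then
       if s then f j (mkseq p L, mkseq w L) - g j (src D j p)
       else g j (tgt D j p) - f j (mkseq w L, mkseq p L)
     else 0.
Proof.
move=> VL fg k s w kw.
(* For each generator, [p] is a source cell of one face and a target cell of another. In the first,
   [a0] is a reply keeping [f] at most [g]; in the second, [b0] is an optimal source cell, keeping
   [f] at least [g]. *)
have /choice[a0 a0P] : forall j, exists z, (j < J)%N -> tgt D j z = src D j p /\
    f j (mkseq p L, mkseq z L) <= g j (src D j p).
  move=> j.
  have [jJ|] := ltnP j J; last by exists p.
  by have [/(_ p erefl)[z zP] _] := fg j jJ p; exists z.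
have /choice[b0 b0P] : forall j, exists z, (j < J)%N -> src D j z = tgt D j p /\
    g j (tgt D j p) <= f j (mkseq z L, mkseq p L).
  move=> j.
  have [jJ|] := ltnP j J; last by exists p.
  have [_ [z []]] := fg j jJ (bwd D j p); rewrite src_bwd// => zE zP.
  by exists z => _; split => //; exact: zP.
(* The neighbour named by [k] and [s], if any, is prescribed to be [w] instead. *)
pose a j := if (k == Some j) && s then w else a0 j.
pose b j := if (k == Some j) && ~~ s then w else b0 j.
have [|p' [pp' _ nb]] := @ball_rich p p a b.
  move=> j jJ; rewrite /a /b; have [sa _] := a0P j jJ.
  have [sb _] := b0P j jJ.
  case: eqP => [kj|] /=; last by rewrite sa sb.
  by have [_] := kw j kj; case: (s) => /= ->; rewrite ?sa ?sb.
exists p'; split => //; rewrite /flow (VL _ _ pp') -addrA lerD2l.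
have termE (j : 'I_J) : f j (src D' j p') - f j (tgt D' j p') =
    f j (mkseq p L, mkseq (a j) L) - f j (mkseq (b j) L, mkseq p L).
  have [/agreeP na /agreeP nb'] := nb j (ltn_ord j).
  by rewrite /= /ball_src /ball_tgt na nb'; move/agreeP: pp' => ->.
rewrite (eq_bigr _ (fun j _ => termE j)).
have le0 (j : 'I_J) : k != Some (j : nat) ->
    f j (mkseq p L, mkseq (a j) L) - f j (mkseq (b j) L, mkseq p L) <=
    g j (src D j p) - g j (tgt D j p).
  move=> /negbTE kj; rewrite /a /b kj /=.
  have [_ ha] := a0P j (ltn_ord j); have [_ hb] := b0P j (ltn_ord j); lra.
case kE: k => [j0|]; last by rewrite addr0; apply: ler_sum => j _; apply: le0; rewrite kE.
have [j0J _] := kw j0 kE.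
rewrite (bigD1 (Ordinal j0J))//= [X in _ <= X + _](bigD1 (Ordinal j0J))//=.
have : \sum_(i < J | i != Ordinal j0J)
    (f i (mkseq p L, mkseq (a i) L) - f i (mkseq (b i) L, mkseq p L)) <=
  \sum_(i < J | i != Ordinal j0J) (g i (src D i p) - g i (tgt D i p)).
  apply: ler_sum => j jj0; apply: le0; rewrite kE; apply: contra jj0 => /eqP[j0j].
  by apply/eqP/val_inj.
have [_ ha] := a0P j0 j0J; have [_ hb] := b0P j0 j0J.
have -> : a j0 = if s then w else a0 j0 by rewrite /a kE eqxx.
have -> : b j0 = if s then b0 j0 else w by rewrite /b kE eqxx; case: (s).
clear -ha hb; case: (s) => /=; lra.
Qed.

(** Adding the indicator of [S] to [f] raises each face value by 0 or 1, and the faces where it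
    rises form the coarse move [T]. The coarse function stays nonnegative because near each point it
    is bounded below by a value of the fine one. *)
Lemma reach_simulates V y' : (forall x y, agree L x y -> V x = V y) ->
  (forall x, 0 <= V x) -> reach D' V y' -> exists f g, simulates V f g y'.
Proof.
move=> VL V0; elim=> {y'} [y yV|y y'' j S _ [f [g [yf gr fg]]]].
  exists (fun _ _ => 0), (fun _ _ => 0); split.
  - by move=> x; rewrite /flow big1 ?addr0.
  - by apply: reach0 => x; rewrite /flow big1 ?addr0.
  - move=> j jJ x0; split; first by move=> x xe; exists (fwd D j x); rewrite -(src_fwd okD jJ).
    by exists x0.
move=> /= jJ y''E y''0.
pose f' i e := f i e + (if i == j then (S e)%:Z else 0).
pose T e := ~~ `[< face_value (f' j) j e (g j e) >].
pose g' i e := g i e + (if i == j then (T e)%:Z else 0).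
have fg' i : (i < J)%N -> forall x0, face_value (f' i) i (src D i x0) (g' i (src D i x0)).
  move=> iJ x0; have := fg i iJ x0; rewrite /g'; case: eqP => [->|ij]; last first.
    have -> : f' i = f i.
      by apply/funext => e; rewrite /f'; case: eqP => // _; rewrite addr0.
    by rewrite addr0.
  set e := src D j x0; rewrite /T; case: asboolP => /=; first by rewrite addr0.
  move=> nfv [lef gef]; rewrite /face_value.
  have f'E z : f' j z = f j z + (S z)%:Z by rewrite /f' eqxx.
  split=> [x /lef[z [ze fz]]|].
    by exists z; split => //; rewrite f'E; case: (S _); lia.
  (* If no source cell secures [g + 1], every source cell has a reply with [f'] at most [g]. As [f]
     is at most [f'], the value would still be [g]. *)
  apply: contrapT => nge; apply: nfv; split; last first.
    have [x [xe xz]] := gef; exists x; split => // z ze.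
    by rewrite f'E; have := xz z ze; case: (S _); lia.
  move=> x xe; apply: contrapT => nz; apply: nge; exists x; split => // z ze.
  by rewrite leNgt; apply/negP => lt; apply: nz; exists z; split => //; lia.
have flowE E h A x : flow E V (fun i e => h i e + (if i == j then (A e)%:Z else 0)) x =
    flow E V h x + (A (src E j x))%:Z - (A (tgt E j x))%:Z.
  rewrite /flow -!addrA; congr (_ + _).
  rewrite (bigD1 (Ordinal jJ))//= [in RHS](bigD1 (Ordinal jJ))//= eqxx.
  rewrite (eq_bigr (fun i : 'I_J => h i (src E i x) - h i (tgt E i x))); first by ring.
  move=> i ij; have /negbTE -> : (i : nat) != j; last by rewrite !addr0.
  by apply: contra ij => /eqP ij; exact/eqP/val_inj.
exists f', g'; split => //.
  by move=> x; rewrite flowE -yf y''E.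
apply: (reachS gr jJ); first by move=> x; rewrite flowE.
move=> p; have [|p' [_]] := @simulates_le V f' g' p VL fg' None true p; first by [].
by rewrite flowE -yf -y''E addr0; exact/le_trans/y''0.
Qed.

(** A coarse point below [U] lifts to a fine one by optimal replies. For the bound, prescribing one
    neighbour and using nonnegativity keeps [f] within [K] of its face value on both sides, which
    costs at most [2K] per generator. *)
Lemma good_ball U V : (forall x y, agree L x y -> U x = U y) ->
  (forall x y, agree L x y -> V x = V y) -> (forall x, 0 <= V x) ->
  good D U V -> good D' U V.
Proof.
move=> UL VL V0 [nU [K bK]]; split.
  move=> y' /(reach_simulates VL V0)[f [g [yf gr fg]]].
  have [p pU] := nU _ gr.
  have [|p' [pp' le']] := @simulates_le V f g p VL fg None true p; first by [].
  by exists p' => //; rewrite yf (UL _ _ pp'); apply: le_lt_trans pU; rewrite -[leRHS]addr0.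
exists (K + J.*2 * K)%N => y' yr x.
have y'0 z : 0 <= y' z by case: yr z => [y yV z|//]; rewrite yV.
move: yr => /(reach_simulates VL V0)[f [g [yf gr fg]]].
have gK := bK _ gr.
have hub j p z : (j < J)%N -> src D j p = tgt D j z ->
    f j (mkseq p L, mkseq z L) - g j (src D j p) <= K%:Z.
  move=> jJ pz.
  have [|p' [_]] := @simulates_le V f g z VL fg (Some j) false p.
    by move=> _ [<-].
  by have := gK z; have := y'0 p'; rewrite yf -pz; lia.
have hlb j p z : (j < J)%N -> src D j p = tgt D j z ->
    - K%:Z <= f j (mkseq p L, mkseq z L) - g j (src D j p).
  move=> jJ pz.
  have [|p' [_]] := @simulates_le V f g p VL fg (Some j) true z.
    by move=> _ [<-].
  by have := gK p; have := y'0 p'; rewrite yf; lia.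
rewrite yf; have -> : flow D' V f x = flow D V g x +
    \sum_(j < J) ((f j (src D' j x) - g j (src D j x)) +
                  (g j (tgt D j x) - f j (tgt D' j x))).
  rewrite /flow -addrA; congr (_ + _); rewrite -big_split; apply: eq_bigr => j _ /=; ring.
rewrite PoszD; apply: lerD (gK x) _.
have -> : (J.*2 * K)%N%:Z = \sum_(j < J) (K%:Z + K%:Z).
  by rewrite sumr_const card_ord -mulr_natr; lia.
apply: ler_sum => j _; apply: lerD.
  by apply: hub => //; exact: src_next.
rewrite /= /ball_tgt -src_prev// -lerN2 opprB; apply: hlb => //.
exact: src_prev.
Qed.

End Ball.

(** * Attracting every point into a given cylinder *)

Section Attract.
Variables (D : stage) (okD : stage_ok D) (c : seq bool) (K : nat).
Let J := gens D.
Let L := depth D.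
Let l := size c.
Let s := K.+1.
Let r := (l + s)%N.
Let L0 := maxn L l.
Let words := enum {: r.-tuple bool}.
Let N := size words.

Let wd (k t : nat) : bool := nth false (nth [tuple of nseq r false] words k) t.
Let tval (t : nat) : bool := nth true c t.
Let pos (k t : nat) : nat := if (t < l)%N then t else (L0 + r + k * s + (t - l))%N.

(** The bits are laid out as [L0] head bits, [r] code bits and [N] blocks of [s] bits. The code
    selects one of [N] pieces of the space; the target set of [k] requires that the point begins
    with [c] and that block [k] consists of ones. *)
Definition codeset k (x : point) : bool := all (fun t => x (L0 + t)%N == wd k t) (iota 0 r).
Definition targetset k (x : point) : bool := all (fun t => x (pos k t) == tval t) (iota 0 r).

Definition attract_depth := (L0 + r + N * s)%N.

(** Both sets fix [r] bits, so an involution can exchange them: it swaps the code bits with the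
    target bits and adds the difference of the two patterns. *)
Definition attract_map k (x : point) : point := fun p =>
  if (L0 <= p < L0 + r)%N then x (pos k (p - L0)) (+) (wd k (p - L0) (+) tval (p - L0))
  else if (p < l)%N then x (L0 + p)%N (+) (wd k p (+) tval p)
  else if (L0 + r + k * s <= p < L0 + r + k * s + s)%N then
    let t := (l + (p - (L0 + r + k * s)))%N in x (L0 + t)%N (+) (wd k t (+) tval t)
  else x p.

Lemma attract_map_code k x t : (t < r)%N ->
  attract_map k x (L0 + t)%N = x (pos k t) (+) (wd k t (+) tval t).
Proof. by move=> tr; rewrite /attract_map leq_addr ltn_add2l tr addKn. Qed.

Lemma attract_map_pos k x t : (t < r)%N ->
  attract_map k x (pos k t) = x (L0 + t)%N (+) (wd k t (+) tval t).
Proof.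
move=> tr; rewrite /attract_map /pos; have lL : (l <= L0)%N by rewrite leq_maxr.
have [tl|lt] := ltnP t l; first by rewrite leqNgt (leq_trans tl lL) /= tl.
have -> : (L0 + r + k * s + (t - l) < L0 + r)%N = false by lia.
rewrite andbF; have -> : (L0 + r + k * s + (t - l) < l)%N = false by lia.
have -> : (L0 + r + k * s <= L0 + r + k * s + (t - l) < L0 + r + k * s + s)%N.
  by rewrite leq_addr ltn_add2l; move: tr; rewrite /r; lia.
by rewrite addKn subnKC.
Qed.

Lemma attract_mapK k : involutive (attract_map k).
Proof.
move=> x; apply/funext => p; rewrite {1}/attract_map.
case: ifPn => [/andP[Lp pL]|pL].
  by rewrite attract_map_pos ?subnKC// ?addbK//; lia.
case: ifPn => pl.
  have pr : (p < r)%N by rewrite /r; lia.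
  rewrite attract_map_code// /pos pl.
  by rewrite addbK.
case: ifPn => pb; last by rewrite /attract_map (negbTE pL) (negbTE pl) (negbTE pb).
have tr : (l + (p - (L0 + r + k * s)) < r)%N by rewrite {2}/r; lia.
rewrite attract_map_code//= addbK /pos ltnNge leq_addr /= addKn.
by rewrite subnKC//; case/andP: pb.
Qed.

Lemma codeset_target k x : codeset k x = targetset k (attract_map k x).
Proof.
apply: eq_in_all => t; rewrite mem_iota => /andP[_ tr]; rewrite attract_map_pos//.
by case: (x _) (wd k t) (tval t) => [] [] [].
Qed.

Lemma pos_lt k t : (k < N)%N -> (t < r)%N -> (pos k t < attract_depth)%N.
Proof.
move=> kN tr; rewrite /pos /attract_depth; case: ifP => tl.
  have : (l <= L0)%N by rewrite leq_maxr.
  lia.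
have : (k * s + s <= N * s)%N by rewrite -mulSnr leq_mul2r kN orbT.
by move: tr; rewrite /r; lia.
Qed.

Lemma code_lt t : (t < r)%N -> (L0 + t < attract_depth)%N.
Proof. by rewrite /attract_depth; lia. Qed.

Lemma depth_attract : (L <= L0 <= attract_depth)%N.
Proof. by rewrite leq_maxl /attract_depth; lia. Qed.

Lemma codeset_agree k x y : agree attract_depth x y -> codeset k x = codeset k y.
Proof.
move=> xy; apply: eq_in_all => t; rewrite mem_iota => /andP[_ tr].
by rewrite xy// code_lt.
Qed.

Lemma targetset_agree k x y : (k < N)%N -> agree attract_depth x y ->
  targetset k x = targetset k y.
Proof.
move=> kN xy; apply: eq_in_all => t; rewrite mem_iota => /andP[_ tr].
by rewrite xy// pos_lt.
Qed.

Lemma attract_map_agree k x y : (k < N)%N -> agree attract_depth x y ->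
  agree attract_depth (attract_map k x) (attract_map k y).
Proof.
move=> kN xy p pL; rewrite /attract_map.
case: ifPn => [pb|_]; first by rewrite xy// pos_lt//; lia.
case: ifPn => [pb|_]; first by rewrite xy// code_lt// /r; lia.
by case: ifPn => [pb|_] /=; rewrite xy// code_lt// {2}/r; lia.
Qed.

Definition attract : stage := Stage (J + N) attract_depth
  (fun j x => if (j < J)%N then src D j x else ([:: codeset (j - J) x], [::]))
  (fun j x => if (j < J)%N then tgt D j x else ([:: targetset (j - J) x], [::]))
  (fun j x => if (j < J)%N then fun t => if (t < L)%N then fwd D j x t else x t
              else attract_map (j - J) x)
  (fun j x => if (j < J)%N then fun t => if (t < L)%N then bwd D j x t else x t
              else attract_map (j - J) x).

Let shallow x y : agree attract_depth x y -> agree L x y.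
Proof. by apply: agree_le; have /andP[] := depth_attract; exact: leq_trans. Qed.

Let splice_agree x y : agree L (fun t => if (t < L)%N then x t else y t) x.
Proof. by move=> t tL; rewrite tL. Qed.

Lemma attract_ok : stage_ok attract.
Proof.
split => /=.
- have := depth_gt0 okD; have /andP[] := depth_attract; lia.
- move=> j jJ x y xy; case: ifPn => jJ'; first exact/(src_agree okD)/shallow.
  by rewrite (codeset_agree _ xy).
- move=> j jJ x y xy; case: ifPn => jJ'; first exact/(tgt_agree okD)/shallow.
  by rewrite (targetset_agree _ xy)//; lia.
- move=> j jJ x y xy; case: ifPn => jJ' t tL; last by apply: (attract_map_agree _ xy) => //; lia.
  by case: ifP => tL'; [exact: (fwd_agree okD jJ' (shallow xy))|exact: xy].
- move=> j jJ x y xy; case: ifPn => jJ' t tL; last by apply: (attract_map_agree _ xy) => //; lia.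
  by case: ifP => tL'; [exact: (bwd_agree okD jJ' (shallow xy))|exact: xy].
- move=> j jJ x; case: (ltnP j J) => jJ'; last by rewrite codeset_target.
  by rewrite (tgt_agree okD jJ' (@splice_agree _ _)); exact: src_fwd.
- move=> j jJ x; case: (ltnP j J) => jJ'; last by rewrite codeset_target attract_mapK.
  by rewrite (src_agree okD jJ' (@splice_agree _ _)); exact: src_bwd.
Qed.

Lemma attract_balanced : balanced D -> balanced attract.
Proof.
move=> bal j /= jJ x; case: (ltnP j J) => jJ'; last by rewrite !attract_mapK.
have [b f] := bal j jJ' x.
split=> t tL; case: (ltnP t L) => // tL'.
  rewrite -[RHS]b//; exact: (bwd_agree okD jJ' (@splice_agree _ _)).
rewrite -[RHS]f//; exact: (fwd_agree okD jJ' (@splice_agree _ _)).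
Qed.

Lemma codeset_cover x : exists2 k, (k < N)%N & codeset k x.
Proof.
pose w := [tuple x (L0 + i)%N | i < r].
have wN : w \in words by rewrite mem_enum.
exists (index w words); first by rewrite index_mem.
apply/allP => t; rewrite mem_iota => /andP[_ tr].
by rewrite /wd nth_index// -[t]/(nat_of_ord (Ordinal tr)) -tnth_nth tnth_mktuple.
Qed.

Lemma codeset_inj k k' x : (k < N)%N -> (k' < N)%N -> codeset k x -> codeset k' x -> k = k'.
Proof.
move=> kN kN' /allP cx /allP cx'.
apply/eqP; rewrite -(nth_uniq [tuple of nseq r false] kN kN' (enum_uniq _)).
apply/eqP/eq_from_tnth => i; rewrite !(tnth_nth false).
have ir : val i \in iota 0 r by rewrite mem_iota /=.
have /eqP := cx _ ir; have /eqP -> := cx' _ ir; exact: esym.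
Qed.

Lemma targetset_sub k x : targetset k x -> mkseq x l = c.
Proof.
move=> /allP tx; apply: (@eq_from_nth _ true); rewrite size_mkseq// => i il.
rewrite nth_mkseq//; have := tx i; rewrite /pos il mem_iota => /(_ _)/eqP -> //.
by rewrite /r; lia.
Qed.

(** There are more codes than the bound [K] permits copies of the cylinder [c]; [s = K.+1] is chosen
    for this. *)
Lemma words_gt : (K.+1 < N)%N.
Proof.
rewrite /N -cardE card_tuple card_bool /r /s.
by have := ltn_expl (l + K.+1) (isT : 1 < 2)%N; lia.
Qed.

(** Code bits and blocks occupy disjoint positions beyond the head, so over the cylinder [c] the
    code and the family of target sets containing the point can be prescribed independently. *)
Lemma attract_rich p i0 (T : nat -> bool) : (i0 < N)%N -> exists p', agree L0 p' p /\
  forall k, (k < N)%N -> codeset k p' = (k == i0) /\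
            targetset k p' = (mkseq p l == c) && T k.
Proof.
move=> i0N.
pose p' : point := fun q => if (q < L0)%N then p q else
  if (q < L0 + r)%N then wd i0 (q - L0) else T ((q - (L0 + r)) %/ s)%N.
have p'p : agree L0 p' p by move=> q qL; rewrite /p' qL.
have ci0 : codeset i0 p'.
  apply/allP => t; rewrite mem_iota => /andP[_ tr].
  have t1 : (L0 + t < L0)%N = false by lia.
  have t2 : (L0 + t < L0 + r)%N by lia.
  by rewrite /p' t1 t2 addKn.
exists p'; split => // k kN; split.
  by apply/idP/eqP => [ck|-> //]; exact: codeset_inj ck ci0.
have lL : (l <= L0)%N by rewrite leq_maxr.
have posE t : (l <= t < r)%N -> p' (pos k t) = T k.
  move=> /andP[lt tr]; rewrite /pos ltnNge lt /= /p'.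
  have -> : (L0 + r + k * s + (t - l) < L0)%N = false by lia.
  have -> : (L0 + r + k * s + (t - l) < L0 + r)%N = false by lia.
  rewrite -[(L0 + r + k * s + _)%N]addnA addKn divnMDl// divn_small ?addn0//.
  by move: tr; rewrite /r; lia.
apply/idP/andP => [tk|[/eqP pc Tk]].
  split; last first.
    have := allP tk l; rewrite posE ?leqnn /r/=; last by lia.
    by rewrite mem_iota /tval nth_default// => /(_ _)/eqP -> //; rewrite /r; lia.
  rewrite -[X in _ == X](targetset_sub tk); apply/eqP/agreeP/agree_sym.
  exact: agree_le lL p'p.
apply/allP => t; rewrite mem_iota => /andP[_ tr]; have [tl|lt] := ltnP t l.
  rewrite /pos tl p'p; last by lia.
  by rewrite -(nth_mkseq true p tl) pc.
by rewrite posE ?lt// Tk /tval nth_default.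
Qed.

(** * Reachability in the attracting stage *)

Definition attract_flow y (h : nat -> int) (x : point) : int :=
  y x + \sum_(k < N) h k * ((codeset k x)%:Z - (targetset k x)%:Z).

Lemma attract_flowE y h p i0 (T : nat -> bool) : (forall x x', agree L x x' -> y x = y x') ->
  (i0 < N)%N -> exists p', agree L0 p' p /\
   attract_flow y h p' = y p + h i0 -
      (mkseq p l == c)%:Z * \sum_(k < N | T k) h k.
Proof.
move=> yL i0N; have [p' [p'p p'E]] := attract_rich p T i0N; exists p'; split => //.
rewrite /attract_flow (yL _ p); last by apply: agree_le p'p; rewrite leq_maxl.
rewrite -!addrA; congr (_ + _).
rewrite mulr_sumr [in RHS]big_mkcond/= [in RHS](_ : h i0 = \sum_(k < N) h k * (k == i0 :> nat)%:Z).
  rewrite -sumrB; apply: eq_bigr => k _; have [-> ->] := p'E k (ltn_ord k).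
  by case: (_ == c) (T k) => [] []; rewrite /=; ring.
rewrite (bigD1 (Ordinal i0N))//= eqxx mulr1 big1 ?addr0// => k ki0.
have /negbTE -> : (k : nat) != i0 by apply: contra ki0 => /eqP ?; exact/eqP/val_inj.
by rewrite mulr0.
Qed.

Lemma reach_agree V y : (forall x x', agree L x x' -> V x = V x') -> reach D V y ->
  forall x x', agree L x x' -> y x = y x'.
Proof.
move=> VL; elim=> [{}y yV|{}y y' j S _ IH jJ yE _] x x' xx; first by rewrite !yV (VL x x').
by rewrite !yE (IH x x' xx) (src_agree okD jJ xx) (tgt_agree okD jJ xx).
Qed.

(** The new generators contribute net multiplicities [h]. These are never all positive: the target
    sets have common points, where more than [K] copies would be needed. *)
Lemma reach_attract V y' : (forall x x', agree L x x' -> V x = V x') ->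
  (forall x, 0 <= V x) -> bounded_reach D V K -> reach attract V y' ->
  exists y h, [/\ reach D V y, forall x, y' x = attract_flow y h x &
                  exists2 k, (k < N)%N & h k <= 0].
Proof.
move=> VL V0 bK; have N0 : (0 < N)%N by have := words_gt; lia.
elim=> {y'} [y yV|y' y'' j S _ [y [h [yr y'E [i0 i0N hi0]]]] /= jN y''E y''0].
  exists y, (fun _ => 0); split; first exact: reach0.
    by move=> x; rewrite /attract_flow big1 ?addr0// => k _; rewrite mul0r.
  by exists 0%N.
have [jJ|Jj] := ltnP j J.
  pose z x := y x + (S (src D j x))%:Z - (S (tgt D j x))%:Z.
  have zE x : y'' x = attract_flow z h x.
    by rewrite y''E jJ y'E /attract_flow /z; ring.
  have zL x x' : agree L x x' -> z x = z x'.
    move=> xx; rewrite /z (src_agree okD jJ xx) (tgt_agree okD jJ xx).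
    by rewrite (reach_agree VL yr xx).
  exists z, h; split => //; last by exists i0.
  apply: (reachS yr jJ) => // p.
  (* At a point with code [i0] outside all target sets, the new value is at most [z p]; hence [z] is
     nonnegative. *)
  have [p' [_ p'E]] := attract_flowE h p pred0 zL i0N.
  have := y''0 p'; rewrite zE p'E big_pred0// mulr0 subr0; lia.
have yL := reach_agree VL yr.
pose d : int := (S ([:: true], [::]))%:Z - (S ([:: false], [::]))%:Z.
pose h' k := h k + (if k == (j - J)%N then d else 0).
have jJN : (j - J < N)%N by lia.
have h'E x : y'' x = attract_flow y h' x.
  rewrite y''E ltnNge Jj /= y'E /attract_flow -!addrA; congr (_ + _).
  rewrite (bigD1 (Ordinal jJN))//= [in RHS](bigD1 (Ordinal jJN))//=.
  rewrite [in RHS](eq_bigr (fun k : 'I_N => h k * ((codeset k x)%:Z - (targetset k x)%:Z))).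
    rewrite /h' eqxx /d; case: (codeset _ x) (targetset _ x) => [] [] /=; ring.
  move=> k kj; rewrite /h'; have /negbTE -> : (k : nat) != (j - J)%N.
    by apply: contra kj => /eqP kj; exact/eqP/val_inj.
  by rewrite addr0.
exists y, h'; split => //; apply: contrapT => nh.
have h'1 k : (k < N)%N -> 1 <= h' k.
  by move=> kN; rewrite leNgt; apply/negP => hk; apply: nh; exists k => //; lia.
pose p : point := nth true c.
(* At a point with code 0 inside all target sets, the term of code 0 cancels, leaving [y p] minus a
   sum over [N.-1 > K] codes. *)
have [p' [_ p'E]] := attract_flowE h' p predT yL N0.
have pc : mkseq p l = c by exact: mkseq_nth.
have := y''0 p'; rewrite h'E p'E pc eqxx mul1r (bigD1 (Ordinal N0))//=.
have : \sum_(k < N | k != Ordinal N0) 1 <= \sum_(k < N | k != Ordinal N0) h' k.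
  by apply: ler_sum => k _; exact: h'1.
rewrite sumr_const (_ : #|_| = N.-1).
  have := bK _ yr p; have := words_gt; rewrite natz; clear.
  by move: (\sum_(_ < _ | _) _) => S'; move: (h' _) (y p) N => hp yp N1; lia.
by have := cardC1 (Ordinal N0); rewrite card_ord => <-; apply: eq_card.
Qed.

(** With a code satisfying [h k <= 0] and no target set, the new value is at most the old one, so
    [U] is still not dominated. Other choices of code and target sets give [|h k| <= K]. *)
Lemma good_attract U V : (forall x x', agree L x x' -> U x = U x') ->
  (forall x x', agree L x x' -> V x = V x') -> (forall x, 0 <= V x) ->
  (forall y, reach D V y -> exists x, y x < U x) -> bounded_reach D V K ->
  good attract U V.
Proof.
move=> UL VL V0 nU bK; split.
  move=> y' /(reach_attract VL V0 bK)[y [h [yr y'E [k kN hk]]]].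
  have [p pU] := nU _ yr.
  have [p' [pp' p'E]] := attract_flowE h p pred0 (reach_agree VL yr) kN.
  exists p' => //; rewrite y'E p'E big_pred0// mulr0 subr0 (UL _ p); first by lia.
  by apply: agree_le pp'; rewrite leq_maxl.
exists (K + N * K)%N => y' y'r x.
have y'0 : forall x, 0 <= y' x by case: y'r => [z zV z'|//]; rewrite zV.
move: y'r => /(reach_attract VL V0 bK)[y [h [yr y'E [k0 k0N hk0]]]].
have yL := reach_agree VL yr.
have hub k : (k < N)%N -> h k <= K%:Z.
  move=> kN; pose p : point := nth true c.
  have [p' [_ p'E]] := attract_flowE h p (pred1 k) yL k0N.
  have pc : mkseq p l = c by exact: mkseq_nth.
  have := y'0 p'; rewrite y'E p'E pc eqxx mul1r (big_pred1 (Ordinal kN)) => [|i] /=.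
    by have := bK _ yr p; lia.
  by rewrite -val_eqE.
have hlb k : (k < N)%N -> - K%:Z <= h k.
  move=> kN; have [p' [_ p'E]] := attract_flowE h x pred0 yL kN.
  have := y'0 p'; rewrite y'E p'E big_pred0// mulr0 subr0.
  by have := bK _ yr x; lia.
rewrite y'E PoszD; apply: lerD; first exact: bK.
have -> : (N * K)%N%:Z = \sum_(k < N) K%:Z.
  by rewrite sumr_const card_ord -mulr_natr; lia.
apply: ler_sum => k _; have := hub k (ltn_ord k); have := hlb k (ltn_ord k).
by case: (codeset k x) (targetset k x) => [] [] /=; lia.
Qed.

End Attract.

(** * Towers of stages and the limit action *)

(** [M] is the length of the prefixes displayed by the new labels. Of the fields, [ext_rich] and
    [ext_flip] serve topological freeness, and [ext_attract] serves minimality. *)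
Record extends (D D' : stage) (c : seq bool) (M : nat) : Prop := Extends {
  ext_gens : (gens D < gens D')%N;
  ext_depth : (depth D <= M < depth D')%N;
  ext_refine : forall j, (j < gens D)%N -> forall x z,
    src D' j x = tgt D' j z -> src D j x = tgt D j z;
  ext_src1 : forall j, (j < gens D')%N -> forall x, (src D' j x).1 = mkseq x M;
  ext_tgt2 : forall j, (j < gens D')%N -> forall x, (tgt D' j x).2 = mkseq x M;
  ext_rich : forall (p : point) (a b : nat -> point),
    (forall j, (j < gens D)%N -> src D j p = tgt D j (a j) /\ src D j (b j) = tgt D j p) ->
    exists p', agree M p' p /\ forall j, (j < gens D)%N ->
      src D' j p' = (mkseq p M, mkseq (a j) M) /\ tgt D' j p' = (mkseq (b j) M, mkseq p M);
  ext_flip : forall z, exists z', ~ agree (depth D') z z' /\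
    forall j, (j < gens D')%N -> src D' j z' = src D' j z /\ tgt D' j z' = tgt D' j z;
  ext_attract : forall x, exists2 j, (j < gens D')%N &
    forall z, src D' j x = tgt D' j z -> mkseq z (size c) = c }.

Lemma extends_ball_attract D (okD : stage_ok D) c K :
  extends D (ball (attract D c K)) c (attract_depth D c K).
Proof.
have okE := attract_ok okD c K.
have [dE1 dE2] := andP (depth_attract D c K).
have refine j : (j < gens D)%N -> forall x z,
    src (ball (attract D c K)) j x = tgt (ball (attract D c K)) j z ->
    src D j x = tgt D j z.
  move=> jD x z [/agreeP xz /agreeP zx].
  have jE : (j < gens (attract D c K))%N by rewrite /= ltn_addr.
  have := src_next okE x jE; rewrite (tgt_agree okE jE zx) /= jD //.
have DE : (gens D <= gens (attract D c K))%N by rewrite leq_addr.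
split=> //.
- by have := words_gt D c K; rewrite /=; lia.
- rewrite (leq_trans dE1 dE2) /=; exact: (ball_depth_gt okE).
- move=> p a b ab.
  pose E := attract D c K.
  pose a' j := if (j < gens D)%N then a j else fwd E j p.
  pose b' j := if (j < gens D)%N then b j else bwd E j p.
  have [j jE|p' [pp _ nb]] := @ball_rich _ okE p p a' b'.
    rewrite /a' /b'; case: (ltnP j (gens D)) => jD.
      by have := ab j jD; rewrite /= jD.
    by rewrite (src_fwd okE jE) (src_bwd okE jE).
  exists p'; split=> // j jD; have [] := nb j (leq_trans jD DE).
  rewrite /a' /b' jD /= /ball_src /ball_tgt => /agreeP -> /agreeP ->.
  by move/agreeP: pp => ->.
- move=> z; pose l := ((gens (attract D c K)).*2.+1 * depth (attract D c K))%N.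
  (* The last bit is read by no label, so flipping it changes the cell but no label. *)
  exists (fun t => if t == l then ~~ z t else z t); split.
    move=> /(_ l); rewrite /= /ball_depth ltnSn eqxx => /(_ isT).
    by case: (z l).
  set z' := fun t => _.
  have zz : agree l z' z by move=> t tl; rewrite /z' ltn_eqF.
  have hz : agree (depth (attract D c K)) z' z.
    by apply: agree_le zz; rewrite leq_pmull.
  have sz k : (k < (gens (attract D c K)).*2)%N ->
      agree (depth (attract D c K)) (slot (attract D c K) k z') (slot (attract D c K) k z).
    by move=> kJ t tL; apply: zz; rewrite /l; nia.
  move=> j jE.
  have s0 : agree (depth (attract D c K))
      (slot (attract D c K) j.*2 z') (slot (attract D c K) j.*2 z).
    by apply: sz; rewrite ltn_double.
  have s1 : agree (depth (attract D c K))
      (slot (attract D c K) j.*2.+1 z') (slot (attract D c K) j.*2.+1 z).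
    by apply: sz; rewrite ltn_Sdouble.
  rewrite /= /ball_src /ball_tgt; split; congr pair; apply/agreeP => //.
    rewrite /next (src_agree okE jE hz) (tgt_agree okE jE s0).
    by case: ifP => _ //; exact: fwd_agree.
  rewrite /prev (tgt_agree okE jE hz) (src_agree okE jE s1).
  by case: ifP => _ //; exact: bwd_agree.
move=> x; have [k kN xk] := codeset_cover D c K x.
have jE : (gens D + k < gens (attract D c K))%N by rewrite ltn_add2l.
exists (gens D + k)%N => // z [/agreeP xz /agreeP zx].
have := src_next okE x jE; rewrite (tgt_agree okE jE zx) /= ltnNge leq_addr /= addKn xk => -[].
by move/esym/targetset_sub.
Qed.

Lemma extend D (U V : point -> int) c : stage_ok D ->
  (forall x y, agree (depth D) x y -> U x = U y) ->
  (forall x y, agree (depth D) x y -> V x = V y) -> (forall x, 0 <= V x) ->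
  good D U V -> exists D', [/\ stage_ok D', good D' U V, balanced D -> balanced D' &
    exists M, extends D D' c M].
Proof.
move=> okD UL VL V0 [nU [K bK]]; have okE := attract_ok okD c K.
have [dE1 dE2] := andP (depth_attract D c K).
have dE x y : agree (depth (attract D c K)) x y -> agree (depth D) x y.
  exact/agree_le/(leq_trans dE1).
exists (ball (attract D c K)); split.
- exact: ball_ok.
- apply: good_ball => //; try by move=> x y /dE; auto.
  exact: good_attract.
- by move=> bal; exact/ball_balanced/attract_balanced.
- by eexists; exact: extends_ball_attract.
Qed.

(** The cylinder to be hit by the generators of the next stage; through [pickle] every word gets its
    turn. *)
Definition target n : seq bool := odflt [::] (unpickle n).

Record tower (D : nat -> stage) (M : nat -> nat) (U V : point -> int) : Prop := Tower {
  tower_ok : forall n, stage_ok (D n);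
  tower_good : forall n, good (D n) U V;
  tower_ext : forall n, extends (D n) (D n.+1) (target n) (M n) }.

Lemma tower_exists D0 U V : stage_ok D0 ->
  (forall x y, agree (depth D0) x y -> U x = U y) ->
  (forall x y, agree (depth D0) x y -> V x = V y) -> (forall x, 0 <= V x) ->
  good D0 U V -> exists D M, [/\ D 0%N = D0, tower D M U V &
    balanced D0 -> forall n, balanced (D n)].
Proof.
move=> ok0 U0 V0 Vge0 good0.
pose P D := [/\ stage_ok D, good D U V, balanced D0 -> balanced D & (depth D0 <= depth D)%N].
have P0 : P D0 by split.
have step (nD : nat * {D | P D}) : exists D'M : {D | P D} * nat,
    extends (sval nD.2) (sval D'M.1) (target nD.1) D'M.2.
  case: nD => n [D [okD gD bD dD]] /=.
  have [||||D' [okD' gD' bD' [M ext]]] := @extend D U V (target n) okD.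
  - by move=> x y /(agree_le dD)/U0.
  - by move=> x y /(agree_le dD)/V0.
  - exact: Vge0.
  - exact: gD.
  have PD' : P D'.
    split=> //; first by auto.
    by have /andP[] := ext_depth ext; lia.
  by exists (exist _ _ PD', M).
have [next nextP] := choice step.
pose T := fix T n : {D | P D} :=
  if n is m.+1 then (next (m, T m)).1 else exist _ _ P0.
exists (fun n => sval (T n)), (fun n => (next (n, T n)).2); split => //.
  by split=> n; [case: (svalP (T n))|case: (svalP (T n))|exact: (nextP (n, T n))].
by move=> b0 n; case: (svalP (T n)); auto.
Qed.

Lemma eq_reach D V y y' : reach D V y -> (forall x, y x = y' x) -> reach D V y'.
Proof. by move=> + /funext <-. Qed.

(** * The homeomorphisms determined by a tower *)

Section Limit.
Variables (D : nat -> stage) (M : nat -> nat) (U V : point -> int).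
Hypothesis tow : tower D M U V.
Let okD n : stage_ok (D n) := tower_ok tow n.
Let ext n := tower_ext tow n.

Lemma tower_gens n : (n <= gens (D n))%N.
Proof. by elim: n => // n IH; have := ext_gens (ext n); lia. Qed.

Lemma tower_gensS j n : (j <= n)%N -> (j < gens (D n.+1))%N.
Proof. by move=> jn; have := tower_gens n.+1; lia. Qed.

Lemma tower_gens_le m n : (m <= n)%N -> (gens (D m) <= gens (D n))%N.
Proof.
elim: n => [|n IH]; first by rewrite leqn0 => /eqP ->.
have hn := ext_gens (ext n).
by rewrite leq_eqVlt => /orP[/eqP -> //|/IH]; lia.
Qed.

Lemma tower_depth n : (n < depth (D n))%N.
Proof.
elim: n => [|n IH]; first exact: depth_gt0.
by have /andP[] := ext_depth (ext n); lia.
Qed.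

Lemma tower_M n : (depth (D n) <= M n < depth (D n.+1))%N.
Proof. exact: ext_depth. Qed.

Lemma tower_M_le m n : (m <= n)%N -> (M m <= M n)%N.
Proof.
elim: n => [|n IH]; first by rewrite leqn0 => /eqP ->.
have /andP[_ h] := tower_M n; have /andP[h' _] := tower_M n.+1.
by rewrite leq_eqVlt => /orP[/eqP -> //|/IH]; lia.
Qed.

Lemma tower_depth_le m n : (m <= n)%N -> (depth (D m) <= depth (D n))%N.
Proof.
elim: n => [|n IH]; first by rewrite leqn0 => /eqP ->.
have hn := tower_M n.
by rewrite leq_eqVlt => /orP[/eqP -> //|/IH]; lia.
Qed.

Definition compat n j x z := src (D n) j x = tgt (D n) j z.

Lemma compat_le m n j x z : (m <= n)%N -> (j < gens (D m))%N ->
  compat n j x z -> compat m j x z.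
Proof.
elim: n => [|n IH]; first by rewrite leqn0 => /eqP ->.
rewrite leq_eqVlt => /orP[/eqP -> //|mn] jm cn; apply: IH => //.
by apply: (ext_refine (ext n)) => //; apply: leq_trans jm _; exact: tower_gens_le.
Qed.

(** A source label displays a prefix of the image; the stage is taken late enough to know the
    generator [j] and to display bit [t]. *)
Definition gen_map j (x : point) : point := fun t =>
  nth false (src (D (maxn j t).+1) j x).2 t.
Definition gen_inv j (x : point) : point := fun t =>
  nth false (tgt (D (maxn j t).+1) j x).1 t.

Lemma compat_src j n x z : (j <= n)%N -> compat n.+1 j x z ->
  (src (D n.+1) j x).2 = mkseq z (M n).
Proof. by move=> jn ->; rewrite (ext_tgt2 (ext n))// tower_gensS. Qed.

Lemma compat_tgt j n x z : (j <= n)%N -> compat n.+1 j x z ->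
  (tgt (D n.+1) j z).1 = mkseq x (M n).
Proof. by move=> jn <-; rewrite (ext_src1 (ext n))// tower_gensS. Qed.

(** Prefixes displayed at different stages are coherent: a cell compatible with [x] at a late stage
    is compatible with it at the earlier ones, and both labels display this cell. *)
Lemma gen_mapE j n x : (j <= n)%N -> (src (D n.+1) j x).2 = mkseq (gen_map j x) (M n).
Proof.
move=> jn.
have coh m m' t : (j <= m <= m')%N -> (t < M m)%N ->
    nth false (src (D m.+1) j x).2 t = nth false (src (D m'.+1) j x).2 t.
  move=> /andP[jm mm'] tm; pose z := fwd (D m'.+1) j x.
  have c' : compat m'.+1 j x z by apply: src_fwd => //; apply: tower_gensS; lia.
  have c : compat m.+1 j x z by apply: compat_le c'; [lia|exact: tower_gensS].
  rewrite (compat_src _ c)// (compat_src _ c') ?nth_mkseq//; last by lia.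
  by apply: leq_trans tm _; exact: tower_M_le.
have szE : size (src (D n.+1) j x).2 = M n.
  by rewrite (src_fwd (okD _) (tower_gensS jn)) (ext_tgt2 (ext n)) ?tower_gensS// size_mkseq.
apply: (@eq_from_nth _ false); rewrite szE ?size_mkseq// => t tn.
rewrite nth_mkseq// /gen_map; set m := maxn j t.
have tm : (t < M m)%N.
  by have := tower_depth m; have := tower_M m; rewrite /m; lia.
have [mn|nm] := leqP m n; last by apply: coh => //; lia.
by apply/esym/coh => //; lia.
Qed.

Lemma gen_invE j n x : (j <= n)%N -> (tgt (D n.+1) j x).1 = mkseq (gen_inv j x) (M n).
Proof.
move=> jn.
have coh m m' t : (j <= m <= m')%N -> (t < M m)%N ->
    nth false (tgt (D m.+1) j x).1 t = nth false (tgt (D m'.+1) j x).1 t.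
  move=> /andP[jm mm'] tm; pose z := bwd (D m'.+1) j x.
  have c' : compat m'.+1 j z x by apply: src_bwd => //; apply: tower_gensS; lia.
  have c : compat m.+1 j z x by apply: compat_le c'; [lia|exact: tower_gensS].
  rewrite (compat_tgt _ c)// (compat_tgt _ c') ?nth_mkseq//; last by lia.
  by apply: leq_trans tm _; exact: tower_M_le.
have szE : size (tgt (D n.+1) j x).1 = M n.
  by rewrite -(src_bwd (okD _) (tower_gensS jn)) (ext_src1 (ext n)) ?tower_gensS// size_mkseq.
apply: (@eq_from_nth _ false); rewrite szE ?size_mkseq// => t tn.
rewrite nth_mkseq// /gen_inv; set m := maxn j t.
have tm : (t < M m)%N.
  by have := tower_depth m; have := tower_M m; rewrite /m; lia.
have [mn|nm] := leqP m n; last by apply: coh => //; lia.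
by apply/esym/coh => //; lia.
Qed.

Lemma compat_map n j x : (j < gens (D n))%N -> compat n j x (gen_map j x).
Proof.
move=> jn; pose m := maxn n j.
have jm : (j <= m)%N by rewrite leq_maxr.
pose z := fwd (D m.+1) j x.
have cm : compat m.+1 j x z by apply: src_fwd => //; exact: tower_gensS.
have c : compat n j x z by apply: compat_le cm => //; rewrite /m; lia.
rewrite /compat c; apply: (tgt_agree (okD n) jn).
have := gen_mapE x jm; rewrite (compat_src jm cm) => /agreeP; apply: agree_le.
have /andP[h _] := tower_M m; apply: leq_trans h; apply: tower_depth_le.
by rewrite leq_maxl.
Qed.

Lemma compat_inv n j x : (j < gens (D n))%N -> compat n j (gen_inv j x) x.
Proof.
move=> jn; pose m := maxn n j.
have jm : (j <= m)%N by rewrite leq_maxr.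
pose z := bwd (D m.+1) j x.
have cm : compat m.+1 j z x by apply: src_bwd => //; exact: tower_gensS.
have c : compat n j z x by apply: compat_le cm => //; rewrite /m; lia.
rewrite /compat -c; apply: (src_agree (okD n) jn).
have := gen_invE x jm; rewrite (compat_tgt jm cm) => /agreeP /agree_sym; apply: agree_le.
have /andP[h _] := tower_M m; apply: leq_trans h; apply: tower_depth_le.
by rewrite leq_maxl.
Qed.

Lemma eq_point_agree x y n0 : (forall n, (n0 <= n)%N -> agree (M n) x y) -> x = y.
Proof.
move=> xy; apply/funext => t; apply: (xy (maxn n0 t)); first by rewrite leq_maxl.
have := tower_M (maxn n0 t); have := tower_depth (maxn n0 t); lia.
Qed.

Lemma gen_mapK j : cancel (gen_map j) (gen_inv j).
Proof.
move=> x; apply: (@eq_point_agree _ _ j) => n jn; apply/agreeP.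
by rewrite -gen_invE// (compat_tgt jn (compat_map _ (tower_gensS jn))).
Qed.

Lemma gen_invK j : cancel (gen_inv j) (gen_map j).
Proof.
move=> x; apply: (@eq_point_agree _ _ j) => n jn; apply/agreeP.
by rewrite -gen_mapE// (compat_src jn (compat_inv _ (tower_gensS jn))).
Qed.

Lemma gen_map_agree j n x y : (j <= n)%N -> agree (depth (D n.+1)) x y ->
  agree (M n) (gen_map j x) (gen_map j y).
Proof.
move=> jn xy; apply/agreeP.
by rewrite -!gen_mapE// (src_agree (okD _) (tower_gensS jn) xy).
Qed.

Lemma gen_inv_agree j n x y : (j <= n)%N -> agree (depth (D n.+1)) x y ->
  agree (M n) (gen_inv j x) (gen_inv j y).
Proof.
move=> jn xy; apply/agreeP.
by rewrite -!gen_invE// (tgt_agree (okD _) (tower_gensS jn) xy).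
Qed.

Lemma gen_map_fwd j n x : (j <= n)%N -> agree (M n) (gen_map j x) (fwd (D n.+1) j x).
Proof.
move=> jn; apply/agreeP; rewrite -gen_mapE//.
by apply: compat_src => //; apply: src_fwd => //; exact: tower_gensS.
Qed.

Lemma gen_map_hits (x : point) c : exists j, mkseq (gen_map j x) (size c) = c.
Proof.
have := ext_attract (ext (pickle c)) x; rewrite /target pickleK /= => -[j jn jc].
by exists j; exact/jc/compat_map.
Qed.

(** * Words in the generators *)

Definition act_letter (a : nat * bool) x := if a.2 then gen_map a.1 x else gen_inv a.1 x.
Definition act_word (w : seq (nat * bool)) x := foldr act_letter x w.

Lemma act_letterK a : cancel (act_letter a) (act_letter (a.1, ~~ a.2)).
Proof. by case: a => j [] x; rewrite /act_letter /= ?gen_mapK ?gen_invK. Qed.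

Lemma act_letter_cont a d : exists d', forall x y, agree d' x y ->
  agree d (act_letter a x) (act_letter a y).
Proof.
exists (depth (D (maxn a.1 d).+1)) => x y xy.
have jn : (a.1 <= maxn a.1 d)%N by rewrite leq_maxl.
have dM : (d <= M (maxn a.1 d))%N.
  by have := tower_M (maxn a.1 d); have := tower_depth (maxn a.1 d); lia.
apply: agree_le dM _; rewrite /act_letter.
by case: ifP => _; [exact: gen_map_agree|exact: gen_inv_agree].
Qed.

Lemma act_word_cont w d : exists d', forall x y, agree d' x y ->
  agree d (act_word w x) (act_word w y).
Proof.
elim: w d => [|a w IH] d /=; first by exists d.
have [d1 h1] := act_letter_cont a d; have [d2 h2] := IH d1.
by exists d2 => x y /h2/h1.
Qed.

Definition lcompat n (a : nat * bool) x z :=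
  if a.2 then compat n a.1 x z else compat n a.1 z x.

Definition run (s : nat -> nat * bool) k x := iteri k (fun i => act_letter (s i)) x.

Definition reduced_run (s : nat -> nat * bool) k :=
  forall i, (i.+1 < k)%N -> s i.+1 <> ((s i).1, ~~ (s i).2).

(* Consecutive letters of a reduced word constrain different neighbours of a
   cell, so a chain of cells along the word can be followed by a single point. *)
Lemma run_chain s k n (ps : nat -> point) : reduced_run s k ->
  (forall i, (i < k)%N -> ((s i).1 < gens (D n))%N) ->
  (forall i, (i < k)%N -> lcompat n (s i) (ps i) (ps i.+1)) ->
  exists x, agree (depth (D n)) x (ps 0%N) /\ agree (depth (D n)) (run s k x) (ps k).
Proof.
elim: k n ps => [|k IH] n ps red sn ch; first by exists (ps 0%N).
(* [ps' i] refines [ps i] so that it sees [ps i.+1] along the letter [s i] and [ps i.-1] back along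
   the letter before. Reducedness makes these two requests concern different slots. *)
have rich i : exists p', (i <= k)%N -> [/\ agree (M n) p' (ps i),
    (if (s i).2 then (src (D n.+1) (s i).1 p').2 = mkseq (ps i.+1) (M n)
     else (tgt (D n.+1) (s i).1 p').1 = mkseq (ps i.+1) (M n)) &
    (0 < i)%N -> if (s i.-1).2 then (tgt (D n.+1) (s i.-1).1 p').1 = mkseq (ps i.-1) (M n)
     else (src (D n.+1) (s i.-1).1 p').2 = mkseq (ps i.-1) (M n)].
  have [ik|] := leqP i k; last by exists (ps i).
  pose a j := if s i == (j, true) then ps i.+1 else
    if (0 < i)%N && (s i.-1 == (j, false)) then ps i.-1 else fwd (D n) j (ps i).
  pose b j := if s i == (j, false) then ps i.+1 else
    if (0 < i)%N && (s i.-1 == (j, true)) then ps i.-1 else bwd (D n) j (ps i).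
  have [j jn|p' [pp nb]] := ext_rich (ext n) (p := ps i) (a := a) (b := b).
    rewrite /a /b; have ci := ch i ik.
    have cp : (0 < i)%N -> lcompat n (s i.-1) (ps i.-1) (ps i).
      by move=> i0; have := ch i.-1; rewrite prednK//; apply; lia.
    split.
      case: eqP ci => [-> //|_ _]; case: andP => [[i0 /eqP sE]|_]; last exact: src_fwd.
      by have := cp i0; rewrite sE.
    case: eqP ci => [-> //|_ _]; case: andP => [[i0 /eqP sE]|_]; last exact: src_bwd.
    by have := cp i0; rewrite sE.
  exists p' => _; split => //.
    have := nb (s i).1 (sn i ik); rewrite /a /b; case: (s i) => j [] /= [h1 h2];
    by rewrite ?h1 ?h2 eqxx.
  move=> i0; have := red i.-1; rewrite prednK// => /(_ ik) red'.
  have := nb (s i.-1).1 (sn i.-1 _); rewrite /a /b i0 => /(_ _) []; first by lia.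
  move: red'; case: (s i.-1) => j [] /= /eqP/negbTE -> h1 h2; by rewrite ?h1 ?h2 eqxx.
have [ps' ps'P] := choice rich.
have sn1 j : (j < gens (D n))%N -> (j < gens (D n.+1))%N.
  by move/leq_trans; apply; exact: tower_gens_le.
(* At the next stage the chain is shorter by one cell. The lost end is recovered below from the
   neighbour that [ps' k] displays. *)
have lift i : (i < k)%N -> lcompat n.+1 (s i) (ps' i) (ps' i.+1).
  move=> ik; have [pp h _] := ps'P i (ltnW ik); have [pp' _ /(_ isT) /= h'] := ps'P i.+1 ik.
  have si := sn1 _ (sn i (ltnW ik)).
  rewrite /lcompat /compat.
  move/agreeP: pp => pp; move/agreeP: pp' => pp'.
  move: h h' si; case: (s i) => j [] /= h h' si.
    rewrite [LHS]surjective_pairing [RHS]surjective_pairing.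
    by rewrite h h' (ext_src1 (ext n))// (ext_tgt2 (ext n))// pp pp'.
  rewrite [LHS]surjective_pairing [RHS]surjective_pairing.
  by rewrite h h' (ext_src1 (ext n))// (ext_tgt2 (ext n))// pp pp'.
have [||x [x0 xk]] := IH n.+1 ps' _ _ lift.
- by move=> i ik; apply: red; rewrite ltnW.
- by move=> i ik; apply/sn1/sn; rewrite ltnW.
have /andP[dM Md] := tower_M n.
exists x; split.
  apply: (agree_trans (y := ps' 0%N)); last by have [pp _ _] := ps'P 0%N isT; exact: agree_le dM pp.
  by apply: agree_le x0; lia.
rewrite /run iteriS -/(run s k x); have [_ h _] := ps'P k (leqnn k).
have kn := sn k (leqnn _).
apply: agree_le dM _; apply/agreeP; rewrite /act_letter.
move: h kn; case: (s k) => j [] /= h kn; rewrite -h.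
  by rewrite -(src_agree (okD _) (sn1 _ kn) xk) (compat_map _ (sn1 _ kn)) (ext_tgt2 (ext n))// sn1.
by rewrite -(tgt_agree (okD _) (sn1 _ kn) xk) -(compat_inv _ (sn1 _ kn)) (ext_src1 (ext n))// sn1.
Qed.

(** The word is followed from [p] through cells. Should the last cell coincide with the first, it is
    replaced by a different cell with the same labels, so the run ends away from its start. *)
Lemma run_not_id s k (p : point) d : (0 < k)%N -> reduced_run s k ->
  exists x, agree d x p /\ run s k x <> x.
Proof.
move=> k0 red; pose n := (d + \max_(i < k) (s i).1.+1)%N.
have sn i : (i < k)%N -> ((s i).1 < gens (D n.+1))%N.
  move=> ik; apply/tower_gensS/(leq_trans _ (leq_addl _ _))/ltnW.
  exact: @leq_bigmax 'I_k (fun i : 'I_k => (s i).1.+1) (Ordinal ik).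
pose ps0 := fix ps0 i := if i is i'.+1 then
  (if (s i').2 then fwd (D n.+1) (s i').1 (ps0 i') else bwd (D n.+1) (s i').1 (ps0 i')) else p.
have ch0 i : (i < k)%N -> lcompat n.+1 (s i) (ps0 i) (ps0 i.+1).
  by move=> /sn si; rewrite /lcompat /compat /=; case: (s i).2; [exact: src_fwd|exact: src_bwd].
have [z' [nz z'E]] := ext_flip (ext n) (ps0 k).
pose ps i := if (i == k) && `[< agree (depth (D n.+1)) (ps0 k) p >] then z' else ps0 i.
have ch i : (i < k)%N -> lcompat n.+1 (s i) (ps i) (ps i.+1).
  move=> ik; rewrite /ps (ltn_eqF ik) /=; case: andP => [[/eqP iE _]|_]; last exact: ch0.
  have := ch0 i ik; rewrite iE /lcompat /compat; have [-> ->] := z'E _ (sn i ik).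
  by [].
have [x [x0 xk]] := run_chain red sn ch; exists x.
have ps00 : ps 0%N = p by rewrite /ps eq_sym (gtn_eqF k0).
split; first by rewrite -ps00; apply: agree_le x0; have := tower_depth n.+1; rewrite /n; lia.
move=> xE; rewrite xE in xk.
have {x0 xk} : agree (depth (D n.+1)) p (ps k).
  by rewrite -ps00; apply: agree_trans (agree_sym x0) xk.
rewrite /ps eqxx /=; case: asboolP => [h h'|h /agree_sym //].
by apply: nz; exact: agree_trans h h'.
Qed.

(** Once labels display [d] bits of the neighbour, pulling [C] back along a letter is a single
    move. *)
Lemma reach_letter a (C : point -> bool) d : (forall x y, agree d x y -> C x = C y) ->
  exists n0, forall n, (n0 <= n)%N -> forall z, (forall x, 0 <= z x) ->
  reach (D n) V (fun x => z x + (C x)%:Z) ->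
  reach (D n) V (fun x => z x + (C (act_letter a x))%:Z).
Proof.
move=> Cd; exists (maxn a.1 d).+1 => -[//|n] nn z z0 r.
have jn : (a.1 <= n)%N by lia.
have dM : (d <= M n)%N by have := tower_M n; have := tower_depth n; lia.
have nthC x : C (nth false (mkseq x (M n))) = C x.
  by apply: Cd => t td; rewrite nth_mkseq//; exact: leq_trans td dM.
have jg := tower_gensS jn.
have pos x : 0 <= z x + (C (act_letter a x))%:Z by have := z0 x; lia.
case: a jn jg pos nn => j [] /= jn jg pos _.
  apply: (@reachS _ _ _ _ j (fun e => C (nth false e.2)) r jg) => // x.
  by rewrite gen_mapE// (ext_tgt2 (ext n))// !nthC /act_letter /=; ring.
(* The complement is moved, since an inverse letter needs the inverse move. *)
apply: (@reachS _ _ _ _ j (fun e => ~~ C (nth false e.1)) r jg) => // x.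
rewrite gen_invE// (ext_src1 (ext n))// !nthC /act_letter /=.
by case: (C x) (C (gen_inv j x)) => [] []; rewrite /=; ring.
Qed.

Lemma reach_word w (C : point -> bool) d : (forall x y, agree d x y -> C x = C y) ->
  exists n0, forall n, (n0 <= n)%N -> forall z, (forall x, 0 <= z x) ->
  reach (D n) V (fun x => z x + (C x)%:Z) ->
  reach (D n) V (fun x => z x + (C (act_word w x))%:Z).
Proof.
elim: w C d => [|a w IH] C d Cd; first by exists 0%N.
have [n1 h1] := reach_letter a Cd; have [d' ad'] := act_letter_cont a d.
have [|n2 h2] := IH (fun x => C (act_letter a x)) d'; first by move=> x y /ad'/Cd.
exists (maxn n1 n2) => n nn z z0 r.
by apply: h2 => //; [lia|apply: h1 => //; lia].
Qed.

(** Pieces are moved one at a time, those not being moved counting as part of the remainder [z]. *)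
Lemma reach_words (s : seq (seq (nat * bool) * (point -> bool))) :
  (forall wC, List.In wC s -> exists d, forall x y, agree d x y -> wC.2 x = wC.2 y) ->
  exists n0, forall n, (n0 <= n)%N -> forall z, (forall x, 0 <= z x) ->
  reach (D n) V (fun x => z x + \sum_(wC <- s) (wC.2 x)%:Z) ->
  reach (D n) V (fun x => z x + \sum_(wC <- s) (wC.2 (act_word wC.1 x))%:Z).
Proof.
elim: s => [|[w C] s IH] Cd.
  by exists 0%N => n _ z _ r; apply: eq_reach r _ => x; rewrite !big_nil.
have [|n1 h1] := IH; first by move=> wC wCs; apply: Cd; right.
have [d /= Cd0] := Cd (w, C) (or_introl erefl).
have [n2 h2] := reach_word w Cd0.
exists (maxn n1 n2) => n nn z z0 r.
have r1 : reach (D n) V (fun x => (z x + \sum_(wC <- s) (wC.2 x)%:Z) + (C (act_word w x))%:Z).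
  apply: h2; first by lia.
    by move=> x; apply: addr_ge0 => //; apply: sumr_ge0.
  by apply: eq_reach r _ => x; rewrite big_cons /=; ring.
have r2 : reach (D n) V (fun x => (z x + (C (act_word w x))%:Z) +
    \sum_(wC <- s) (wC.2 (act_word wC.1 x))%:Z).
  apply: h1; first by lia.
    by move=> x; apply: addr_ge0.
  by apply: eq_reach r1 _ => x; ring.
by apply: eq_reach r2 _ => x; rewrite big_cons /=; ring.
Qed.

(** [V] is the sum of the pieces and a nonnegative remainder. Moving the pieces gives a reachable
    function, which drops below [U] somewhere; without the remainder it is no larger there. *)
Lemma no_subequivalence (s : seq (seq (nat * bool) * (point -> bool))) :
  (forall wC, List.In wC s -> exists d, forall x y, agree d x y -> wC.2 x = wC.2 y) ->
  (forall x, \sum_(wC <- s) (wC.2 x)%:Z <= V x) ->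
  exists x, \sum_(wC <- s) (wC.2 (act_word wC.1 x))%:Z < U x.
Proof.
move=> /reach_words[n0 h] sV.
have z0 x : 0 <= V x - \sum_(wC <- s) (wC.2 x)%:Z by rewrite subr_ge0.
have r := h n0 (leqnn _) _ z0 (reach0 (D n0) (fun x => subrK _ _)).
have [x xU] := (tower_good tow n0).1 _ r.
exists x => //; apply: le_lt_trans xU; rewrite lerDr subr_ge0; exact: sV.
Qed.

End Limit.

(** * Two base configurations *)

Fixpoint bitwords n : seq (seq bool) :=
  if n is n'.+1 then [seq b :: w | b <- [:: false; true], w <- bitwords n'] else [:: [::]].

Lemma mem_bitwords n (w : seq bool) : (w \in bitwords n) = (size w == n).
Proof.
elim: n w => [|n IH] [|b w] //=; first by rewrite cats0 mem_cat; apply/negbTE/norP; split;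
  apply/mapP => -[].
by rewrite cats0 mem_cat eqSS -IH; case: b; rewrite ?(mem_map (fun _ _ => _));
  do ?[by move=> ? ? []]; [rewrite orbC|]; rewrite -[RHS]orbF; congr (_ || _);
  apply/negbTE/mapP => -[].
Qed.

Lemma bitwords_uniq n : uniq (bitwords n).
Proof.
elim: n => //= n IH; rewrite cats0 cat_uniq !map_inj_uniq ?IH//=; try by move=> w w' [].
by rewrite andbT; apply/hasPn => w /mapP[w' _ ->]; apply/mapP => -[].
Qed.

Definition base n L (P Q : nat -> pred (seq bool)) (f b : nat -> point -> point) : stage :=
  Stage n L (fun j x => ([:: P j (mkseq x L)], [::])) (fun j x => ([:: Q j (mkseq x L)], [::]))
    f b.

Lemma src_base n L P Q f b j x :
  src (base n L P Q f b) j x = ([:: P j (mkseq x L)], [::]).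
Proof. by []. Qed.

Lemma tgt_base n L P Q f b j x :
  tgt (base n L P Q f b) j x = ([:: Q j (mkseq x L)], [::]).
Proof. by []. Qed.

(** A finite check: removing [A] and adding [B] turns each member of the family [R] into another
    member, unless some value becomes negative. *)
Definition exchange_closed n L (P Q : nat -> pred (seq bool)) m (R : nat -> pred (seq bool)) :=
  let step A B i := has (fun w => R i w + B w < A w)%N (bitwords L) ||
    has (fun i' => all (fun w => R i' w + A w == R i w + B w)%N (bitwords L)) (iota 0 m) in
  all (fun i => all (fun j => step (P j) (Q j) i && step (Q j) (P j) i) (iota 0 n)) (iota 0 m).

Lemma reach_base n L P Q f b m R V y : exchange_closed n L P Q m R ->
  (0 < m)%N -> (forall x, V x = (R 0%N (mkseq x L))%:Z) ->
  reach (base n L P Q f b) V y -> exists2 i, (i < m)%N & forall x, y x = (R i (mkseq x L))%:Z.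
Proof.
move=> /allP cl m0 VR; elim=> {y} [y yV|y y' j S _ [i im yR] /= jn y'E y'0].
  by exists 0%N => // x; rewrite yV.
have im' : i \in iota 0 m by rewrite mem_iota.
have jn' : j \in iota 0 n by rewrite mem_iota.
have /allP/(_ j jn')/andP[st1 st2] := cl i im'.
have inL x : mkseq x L \in bitwords L by rewrite mem_bitwords size_mkseq.
have main (A B : pred (seq bool)) :
    has (fun w => R i w + B w < A w)%N (bitwords L) ||
    has (fun i' => all (fun w => R i' w + A w == R i w + B w)%N (bitwords L)) (iota 0 m) ->
    (forall x, y' x = y x - (A (mkseq x L))%:Z + (B (mkseq x L))%:Z) ->
    exists2 i, (i < m)%N & forall x, y' x = (R i (mkseq x L))%:Z.
  move=> /orP[/hasP[w wL wlt]|/hasP[i' i'm /allP i'E]] yE.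
    exfalso; have := y'0 (nth false w); rewrite yE yR.
    have -> : mkseq (nth false w) L = w.
      by move: wL; rewrite mem_bitwords => /eqP <-; exact: mkseq_nth.
    by move: wlt; lia.
  exists i'; first by move: i'm; rewrite mem_iota.
  move=> x; rewrite yE yR; have /eqP := i'E _ (inL x).
  by case: (R i' _) (A _) (R i _) (B _) => [] [] [] [].
pose s b' := S ([:: b'], [::]).
have y'E' x : y' x = y x + (s (P j (mkseq x L)))%:Z - (s (Q j (mkseq x L)))%:Z by [].
(* Only a set separating the two labels changes the function; the two ways of doing so are opposite
   exchanges. *)
case st: (s true); case sf: (s false).
- exists i => // x; rewrite y'E' -yR.
  by case: (P j _); case: (Q j _); rewrite ?st ?sf; ring.
- apply: main st2 _ => x; rewrite y'E'.
  by case: (P j _); case: (Q j _); rewrite ?st ?sf /=; ring.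
- apply: main st1 _ => x; rewrite y'E'.
  by case: (P j _); case: (Q j _); rewrite ?st ?sf /=; ring.
- exists i => // x; rewrite y'E' -yR.
  by case: (P j _); case: (Q j _); rewrite ?st ?sf; ring.
Qed.

Lemma good_base n L P Q f b m R (U V : point -> int) (U0 : pred (seq bool)) :
  exchange_closed n L P Q m R -> (0 < m)%N ->
  (forall x, V x = (R 0%N (mkseq x L))%:Z) -> (forall x, U x = (U0 (mkseq x L))%:Z) ->
  all (fun i => has (fun w => U0 w && ~~ R i w) (bitwords L)) (iota 0 m) ->
  good (base n L P Q f b) U V.
Proof.
move=> cl m0 VR UU0 /allP nU; split.
  move=> y /(reach_base cl m0 VR)[i im yE].
  have := nU i; rewrite mem_iota => /(_ im) /= /hasP[w wL /andP[Uw /negbTE Rw]].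
  have wE : mkseq (nth false w) L = w.
    by move: wL; rewrite mem_bitwords => /eqP <-; exact: mkseq_nth.
  by exists (nth false w) => //; rewrite UU0 yE wE Uw Rw.
exists 1%N => y /(reach_base cl m0 VR)[i im yE] x.
by rewrite yE; case: (R i _).
Qed.

Lemma base_agree L (A : seq bool -> label) x y : agree L x y ->
  A (mkseq x L) = A (mkseq y L).
Proof. by move/agreeP => ->. Qed.

(* Six of the eight words of length 3 form a table with three rows and two columns.
   The generators exchange the columns and exchange the rows, so twice a column is
   three times a row, but no column reaches a superset of a row. *)
Definition table_row (k : nat) : pred (seq bool) := fun w =>
  (nth false w 0 == (k == 2)) && (nth false w 1 == (k == 1)).
Definition table_col (i : bool) : pred (seq bool) := fun w =>
  ~~ (nth false w 0 && nth false w 1) && (nth false w 2 == i).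

Definition flip k (x : point) : point := fun t => if t == k then ~~ x t else x t.

Definition table_src j := if j is k.+1 then table_row 0 else table_col false.
Definition table_tgt j := if j is k.+1 then table_row k.+1 else table_col true.
(** The rows begin with 00, 01 and 10, so flipping bit 1 takes row 0 to row 1 and flipping bit 0
    takes it to row 2. *)
Definition table_map j := if j is k.+1 then flip (1 - k)%N else flip 2.

Definition table : stage := base 3 3 table_src table_tgt table_map table_map.

Lemma flipK k : involutive (flip k).
Proof. by move=> x; apply/funext => t; rewrite /flip; case: eqP => //; rewrite negbK. Qed.

Lemma flip_agree n k x y : agree n x y -> agree n (flip k x) (flip k y).
Proof. by move=> xy t tn; rewrite /flip xy. Qed.

Lemma table_mapK j : involutive (table_map j).
Proof. by case: j => [|j]; exact: flipK. Qed.

Lemma table_compat j x : (j < 3)%N -> src table j x = tgt table j (table_map j x).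
Proof.
case: j => [|[|[|//]]] _ /=; rewrite /base /= /table_row /table_col /flip /=;
by case: (x 0%N) (x 1%N) (x 2) => [] [] [].
Qed.

Lemma table_ok : stage_ok table.
Proof.
split => //.
- by move=> j _ x y; exact: (base_agree (fun w => ([:: table_src j w], [::]))).
- by move=> j _ x y; exact: (base_agree (fun w => ([:: table_tgt j w], [::]))).
- by move=> [|j] _ x y; exact: flip_agree.
- by move=> [|j] _ x y; exact: flip_agree.
- by move=> j jn x; exact: table_compat.
- by move=> j jn x; rewrite table_compat// /= table_mapK.
Qed.

Lemma table_balanced : balanced table.
Proof. by move=> j _ x; rewrite /= !table_mapK. Qed.

(** Starting from a column, only the two columns are reachable: no column contains a row, so every
    proper row exchange would create a negative value. *)
Lemma table_good : good table (fun x => (table_row 0 (mkseq x 3))%:Z)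
  (fun x => (table_col false (mkseq x 3))%:Z).
Proof.
by apply: (@good_base _ _ _ _ _ _ 2 (fun i => table_col (i == 1%N)) _ _ (table_row 0)) => //.
Qed.

(* The space is partitioned into [part 0], .., [part 3], and also into [part 4],
   [part 5], [part 6]; the generators exchange [part 0] with all of them. *)
Definition part (k : nat) : pred (seq bool) := fun w =>
  match k with
  | 0 => ~~ nth false w 0 && ~~ nth false w 1
  | 1 => ~~ nth false w 0 && nth false w 1
  | 2 => nth false w 0 && ~~ nth false w 1
  | 3 => nth false w 0 && nth false w 1
  | 4 => ~~ nth false w 2
  | 5 => nth false w 2 && ~~ nth false w 3
  | _ => nth false w 2 && nth false w 3
  end.

(** Sample points inside and outside each part. The parts exchanged may have different numbers of
    words, so the maps built from these samples are not bijections. *)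
Definition inside k : point := nth false
  (nth [:: true; true; true; true]
    [:: [::]; [:: false; true]; [:: true; false]; [:: true; true];
        [::]; [:: false; false; true; false]] k).
Definition outside k : point := nth false
  (if k == 3 then [::] else if (k < 4)%N then [:: true; true; true; true]
   else if k == 4 then [:: true; true; true; true] else [:: true]).

Definition paradox_fwd j x := if part 0 (mkseq x 4) then inside j.+1 else outside j.+1.
Definition paradox_bwd j x := if part j.+1 (mkseq x 4) then inside 0 else outside 0.

Definition paradox : stage :=
  base 6 4 (fun _ => part 0) (fun j => part j.+1) paradox_fwd paradox_bwd.

Lemma part_inside k : (k < 7)%N -> part k (mkseq (inside k) 4).
Proof. by case: k => [|[|[|[|[|[|[|//]]]]]]]. Qed.

Lemma part_outside k : (k < 7)%N -> part k (mkseq (outside k) 4) = false.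
Proof. by case: k => [|[|[|[|[|[|[|//]]]]]]]. Qed.

Lemma paradox_ok : stage_ok paradox.
Proof.
split => //.
- by move=> j _ x y; exact: (base_agree (fun w => ([:: part 0 w], [::]))).
- by move=> j _ x y; exact: (base_agree (fun w => ([:: part j.+1 w], [::]))).
- by move=> j _ x y; rewrite /paradox/= /paradox_fwd => /agreeP ->.
- by move=> j _ x y; rewrite /paradox/= /paradox_bwd => /agreeP ->.
- move=> j jn x; rewrite /paradox src_base tgt_base [fwd _ _ _]/(paradox_fwd j x) /paradox_fwd.
  by case: ifP => p0; rewrite ?part_inside ?part_outside.
- move=> j jn x; rewrite /paradox src_base tgt_base [bwd _ _ _]/(paradox_bwd j x) /paradox_bwd.
  by case: ifP => p0; rewrite ?part_inside ?part_outside.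
Qed.

(** No part contains another, so from the indicator of a part one can only exchange that very part;
    and no part is the whole space. *)
Lemma paradox_good : good paradox (fun _ => 1) (fun x => (part 0 (mkseq x 4))%:Z).
Proof.
by apply: (@good_base _ _ _ _ _ _ 7 part _ _ predT) => //.
Qed.

(** * Topology of the limit action *)

(** Otherwise points outside [O] that agree with [x] to growing depth would converge to [x]. *)
Lemma nbhs_cantor (x : cantor_space) (O : set cantor_space) : nbhs x O ->
  exists n, forall y, agree n x y -> O y.
Proof.
move=> xO; apply: contrapT => nO.
have /choice[g gP] : forall n, exists y, agree n x y /\ ~ O y.
  move=> n; apply: contrapT => ny; apply: nO; exists n => y xy.
  by apply: contrapT => Oy; apply: ny; exists y.
have gx : (g : nat -> cantor_space) @ \oo --> x.
  apply/cvg_sup => N W [V] [[B] oB <-] Bx BW.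
  apply: (filterS BW); rewrite nbhs_simpl; exists N.+1 => // i /= Ni.
  by have [xg _] := gP i; rewrite /= -xg.
have [n _ /(_ n (leqnn n))] := gx _ xO.
by have [_] := gP n.
Qed.

Lemma open_agree (P : set cantor_space) n :
  (forall x y, agree n x y -> P x -> P y) -> open P.
Proof.
have oc : forall (p : cantor_space), open [set y : cantor_space | agree n p y].
  move=> p; elim: n => [|m IH].
    by rewrite (_ : mkset _ = setT); [exact: openT|apply/seteqP; split].
  rewrite (_ : mkset _ = [set y | agree m p y] `&` (@proj nat (fun _ => bool) m) @^-1` [set p m]).
    apply: openI => //; apply: open_comp; last exact: discrete_open.
    by move=> y _; exact: proj_continuous.
  apply/seteqP; split => [y py|y [py pm] i].
    by split; [exact: agree_le py|rewrite /= /proj py].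
  by rewrite ltnS leq_eqVlt => /orP[/eqP ->|/py //].
move=> Pn; rewrite openE => x Px; rewrite /interior.
apply: (filterS (P := [set y | agree n x y])); first by move=> y xy; exact: Pn xy Px.
by apply: open_nbhs_nbhs; split.
Qed.

Lemma continuous_agree (f : cantor_space -> cantor_space) :
  (forall d, exists d', forall x y, agree d' x y -> agree d (f x) (f y)) -> continuous f.
Proof.
move=> fd; apply/continuousP => O oO; rewrite openE => x Ofx.
have [d dO] := nbhs_cantor (open_nbhs_nbhs (conj oO Ofx)).
have [d' d'f] := fd d.
rewrite /interior; apply: (filterS (P := [set y | agree d' x y])).
  by move=> y xy; exact/dO/d'f.
apply: open_nbhs_nbhs; split => //.
by apply: (@open_agree _ d') => y z yz xy; exact: agree_trans xy yz.
Qed.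

Section Action.
Variables (D : nat -> stage) (M : nat -> nat) (U V : point -> int).
Hypothesis tow : tower D M U V.

Definition action (u : F_infty) (x : cantor_space) : cantor_space :=
  act_word D (free_word u) x.

Lemma act_push b w x : act_word D (push b w) x = act_letter D b (act_word D w x).
Proof.
case: w => [|c w] //=; case: ifPn => //= /eqP ->.
case: b => j b; have := act_letterK tow (j, ~~ b) (act_word D w x).
by rewrite /letter_inv /= negbK.
Qed.

Lemma actionM u v x : action (u * v)%g x = action u (action v x).
Proof.
rewrite /action /=; case: u => u ru /=; elim: u {ru} => //= b u IH.
by rewrite act_push IH.
Qed.

Lemma action1 x : action 1%g x = x.
Proof. by []. Qed.

Lemma actionK u : cancel (action u) (action u^-1).
Proof. by move=> x; rewrite -actionM mulVg. Qed.

Lemma actionVK u : cancel (action u^-1) (action u).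
Proof. by move=> x; rewrite -actionM mulgV. Qed.

Lemma action_agree u d : exists d', forall x y, agree d' x y -> agree d (action u x) (action u y).
Proof. exact: act_word_cont tow (free_word u) d. Qed.

Lemma action_homeo : acts_by_homeomorphisms action.
Proof.
split; [exact: action1|exact: actionM|].
by move=> g; apply: continuous_agree; exact: action_agree.
Qed.

Lemma action_gen j x : action (free_gen j) x = gen_map D j x.
Proof. by []. Qed.

Lemma action_minimal : minimal_action action.
Proof.
move=> x O [y Oy] oO.
have [n nO] := nbhs_cantor (open_nbhs_nbhs (conj oO Oy)).
have [j jE] := gen_map_hits tow x (mkseq y n).
exists (gen_map D j x); split; last by exists (free_gen j).
by apply: nO; move: jE; rewrite size_mkseq => /agreeP/agree_sym.
Qed.

Lemma run_act_word (w : seq (nat * bool)) x a0 :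
  act_word D w x = run D (fun i => nth a0 (rev w) i) (size w) x.
Proof.
elim/last_ind: w x => [|w a IH] x //.
rewrite /act_word foldr_rcons -/(act_word D w _) IH size_rcons rev_rcons /run.
elim: (size w) => //= n IHn; by rewrite IHn.
Qed.

Lemma action_topologically_free : topologically_free action.
Proof.
move=> g g1; apply/seteqP; split => // x xfix.
have [d dfix] := nbhs_cantor xfix.
have gE : free_word g <> [::] by move=> gE; apply: g1; exact: val_inj.
(* The last letter of a word acts first, hence the reversal. *)
pose s i := nth (0%N, true) (rev (free_word g)) i.
have s0 : (0 < size (free_word g))%N by case: (free_word g) gE.
have red : reduced_run s (size (free_word g)).
  move=> i il; rewrite /s !nth_rev ?(ltnW il)//.
  have := valP g; rewrite /= /reduced => /(sortedP (0%N, true)).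
  move=> /(_ (size (free_word g) - i.+2)%N).
  have -> : ((size (free_word g) - i.+2).+1 = size (free_word g) - i.+1)%N by lia.
  have lt : (size (free_word g) - i.+1 < size (free_word g))%N by rewrite ltn_subrL.
  move=> /(_ lt)/eqP h E; apply: h.
  by rewrite /letter_inv E /= negbK -surjective_pairing.
have [y [yx]] := run_not_id tow x d s0 red.
by rewrite /s -run_act_word; apply; apply: dfix; exact: agree_sym.
Qed.

End Action.

(** * Failure of dynamical subequivalence *)

Lemma sum_uniq_true (T : eqType) (s : seq T) (b : pred T) (v : bool) : uniq s ->
  {in s &, forall w w', b w -> b w' -> w = w'} -> {in s, forall w, b w -> v} ->
  (\sum_(w <- s) (b w)%:Z <= v%:Z)%R.
Proof.
move=> us ub bv; have [/hasP[w ws bw]|/hasPn nb] := boolP (has b s); last first.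
  by rewrite big_seq big1 // => w /nb /negbTE ->.
rewrite (bv w ws bw) (bigD1_seq w)//= bw big_seq_cond big1 ?addr0//.
move=> w' /andP[w's ww']; case bw' : (b w') => //.
by rewrite (ub w' w) ?eqxx// in ww'.
Qed.

Lemma lebesgue_number (K : set cantor_space) (n : nat) (W : 'I_n -> set cantor_space) :
  compact K -> (forall i, open (W i)) -> K `<=` \bigcup_i W i ->
  exists L, forall x, K x -> exists i, forall y, agree L x y -> W i y.
Proof.
move=> /compact_near_coveringP cK oW KW.
have := cK nat \oo (fun L x => exists i, forall y, agree L x y -> W i y) _.
case=> [x Kx|L0 _ /(_ L0 (leqnn _)) h]; last by exists L0 => x /h.
have [i _ Wix] := KW x Kx.
have [m mW] := nbhs_cantor (open_nbhs_nbhs (conj (oW i) Wix)).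
exists ([set x' | agree m x x'], [set L | (m <= L)%N]); first split.
- apply: open_nbhs_nbhs; split => //.
  by apply: (@open_agree _ m) => y z yz xy; exact: agree_trans xy yz.
- by exists m.
- move=> [x' L] /= [xx' mL]; exists i => y x'y.
  by apply: mW; apply: agree_trans xx' _; exact: agree_le x'y.
Qed.

(** The sets [W i] are cut into cylinders of one length. Their images are disjoint pieces of [Vs],
    and moving these pieces back covers [Us], against [no_subequivalence]. *)
Lemma not_subequivalent D M (Us Vs : pred point) d :
  (forall x y, agree d x y -> Us x = Us y) ->
  tower D M (fun x => (Us x)%:Z) (fun x => (Vs x)%:Z) ->
  ~ dyn_subequivalent (action D) [set x | Us x] [set x | Vs x].
Proof.
move=> Ud tow sub; have actK := actionK tow.
have cU : compact [set x : cantor_space | Us x].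
  apply: (subclosed_compact _ cantor_space_compact) => //.
  rewrite -openC; apply: (@open_agree _ d) => x y xy /=.
  by rewrite (Ud x y xy).
(* [Us] is clopen, so it can itself serve as the compact set. *)
have [n [W [g [n1 oW UW dW WV]]]] := sub _ cU (@subset_refl _ _).
have [L LW] := lebesgue_number cU oW UW.
have /choice[ix ixP] : forall w, exists i : 'I_n,
    (exists i, forall y, mkseq y L = w -> W i y) -> forall y, mkseq y L = w -> W i y.
  move=> w; have [[i iW]|nW] := pselect (exists i, forall y, mkseq y L = w -> W i y).
    by exists i.
  (* An arbitrary default for words whose cylinder lies in no [W i]. *)
  by exists (Ordinal n1).
pose cells := [seq w <- bitwords L | `[< exists i, forall y, mkseq y L = w -> W i y >]].
(* [C w] indicates the image of the cylinder [w] under the group element assigned to it. *)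
pose C w (x : point) := mkseq (action D (g (ix w))^-1%g x) L == w.
pose s := [seq (free_word (g (ix w)), C w) | w <- cells].
have uc : uniq cells by apply/filter_uniq/bitwords_uniq.
have CW w x : w \in cells -> C w x -> (action D (g (ix w)) @` W (ix w)) x.
  rewrite mem_filter => /andP[/asboolP ex _] /eqP Cw.
  exists (action D (g (ix w))^-1%g x); last exact: actionVK tow _ x.
  exact: ixP.
have [||x] := @no_subequivalence _ _ _ _ tow s.
- move=> wC /List.in_map_iff[w [<- _]] /=.
  have [d' d'P] := action_agree tow (g (ix w))^-1%g L.
  by exists d' => x y /d'P/agreeP; rewrite /C => ->.
- move=> x; rewrite big_map /=; apply: sum_uniq_true => //.
  + move=> w w' ws ws' Cw Cw'.
    have [eqi|nei] := eqVneq (ix w) (ix w').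
      by move: Cw Cw'; rewrite /C eqi => /eqP <- /eqP.
    have := dW _ _ nei; move/seteqP => [/(_ x) h _]; exfalso; apply: h.
    by split; exact: CW.
  + by move=> w ws Cw; apply: WV; exact: CW Cw.
rewrite big_map /=; case Ux : (Us x) => /=; last first.
  by rewrite ltNge sumr_ge0.
have xc : mkseq x L \in cells.
  rewrite mem_filter mem_bitwords size_mkseq eqxx andbT; apply/asboolP.
  by have [i iW] := LW x Ux; exists i => y /agreeP/agree_sym; exact: iW.
rewrite (bigD1_seq (mkseq x L))//= {1}/C [X in mkseq X _](actK _ x) eqxx.
have : (0 <= \sum_(i <- cells | i != mkseq x L)
   (C i (act_word D (free_word (g (ix i))) x))%:Z :> int)%R by apply: sumr_ge0.
by move=> h; rewrite ltNge lerDl h.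
Qed.

(** * The Bernoulli measure *)

Definition clopen_system : set (set cantor_space) :=
  [set P | exists n, forall x y, agree n x y -> P x -> P y].

Lemma clopen_system_open P : clopen_system P -> open P.
Proof. by move=> [n]; exact: open_agree. Qed.

Lemma clopen_setI_closed : setI_closed clopen_system.
Proof.
move=> P Q [n Pn] [m Qm]; exists (maxn n m) => x y xy [Px Qx]; split.
  by apply: Pn Px; apply: agree_le xy; rewrite leq_maxl.
by apply: Qm Qx; apply: agree_le xy; rewrite leq_maxr.
Qed.

(** An open set is the union over [n] of the clopen sets of points whose cylinder of length [n] it
    contains. *)
Lemma borel_clopen : @measurable _ (borel cantor_space) = <<s clopen_system >>.
Proof.
apply/seteqP; split; last by apply: sub_sigma_algebra2; exact: clopen_system_open.
apply: smallest_sub; first exact: smallest_sigma_algebra.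
move=> O oO; rewrite (_ : O = \bigcup_n [set x | forall y, agree n x y -> O y]).
  apply: sigma_algebra_bigcup => n; apply: sub_sigma_algebra; exists n.
  by move=> x y xy Ox z yz; apply: Ox; exact: agree_trans xy yz.
apply/seteqP; split=> [x Ox|x [n _ /(_ x)]]; last exact.
have [n nO] := nbhs_cantor (open_nbhs_nbhs (conj oO Ox)); by exists n.
Qed.

Lemma measurable_clopen (P : set (borel cantor_space)) : clopen_system P -> measurable P.
Proof. by rewrite borel_clopen; exact: sub_sigma_algebra. Qed.

Lemma measurable_mkseq n (P : pred (seq bool)) :
  measurable ([set x | P (mkseq x n)] : set (borel cantor_space)).
Proof. by apply: measurable_clopen; exists n => x y /agreeP /= ->. Qed.

Lemma measurable_fun_clopen d (T : measurableType d) (f : T -> borel cantor_space) :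
  (forall P, clopen_system P -> measurable (f @^-1` P)) -> measurable_fun setT f.
Proof.
move=> mf; apply: (@measurability _ _ _ _ setT f clopen_system borel_clopen).
by move=> _ [P cP <-]; rewrite setTI; exact: mf.
Qed.

Section Coin.
Variable R : realType.

Lemma borel_prob_unique (mu nu : probability (borel cantor_space) R) :
  (forall P, clopen_system P -> mu P = nu P) -> forall A, measurable A -> mu A = nu A.
Proof.
move=> munu A mA.
apply: (@measure_unique _ R (borel cantor_space) clopen_system (fun=> setT) borel_clopen
  clopen_setI_closed _ _ mu nu) => //.
- by move=> _; exists 0%N.
- by rewrite bigcup_const.
- by move=> _; apply: le_lt_trans (probability_le1 _ _) _ => //; exact: ltry.
Qed.

Definition halves (n : nat) : R := 2^-1 ^+ n.

Lemma halves_gt0 n : 0 < halves n.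
Proof. by rewrite exprn_gt0// invr_gt0. Qed.

Lemma halvesS n : halves n.+1 = halves n / 2.
Proof. by rewrite /halves exprSr. Qed.

(** The doubling map of the unit interval; along its orbits, comparison with one half reads off
    binary digits. *)
Definition doubling (t : R) : R := if 2^-1 <= t then 2 * t - 1 else 2 * t.
Definition bits (t : measurableTypeR R) : borel cantor_space := fun k => 2^-1 <= iter k doubling t.

Lemma doublingE t : doubling t = 2 * t - (2^-1 <= t)%R%:R.
Proof. by rewrite /doubling; case: ifP; rewrite ?subr0. Qed.

Lemma doubling_itv t : 0 <= t < 1 -> 0 <= doubling t < 1.
Proof. by rewrite /doubling; case: ifPn; rewrite -?ltNge; lra. Qed.

Lemma iter_doubling_itv n t : 0 <= t < 1 -> 0 <= iter n doubling t < 1.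
Proof. by elim: n => //= n IH /IH; exact: doubling_itv. Qed.

(** The left end of the dyadic interval of numbers whose first [n] binary digits are those of
    [p]. *)
Definition dyadic (p : point) n : R := \sum_(i < n) (p i)%:R * halves i.+1.

Lemma dyadicS p n : dyadic p n.+1 = dyadic p n + (p n)%:R * (halves n / 2).
Proof. by rewrite /dyadic big_ord_recr /= halvesS. Qed.

Lemma dyadic_itv p n : 0 <= dyadic p n /\ dyadic p n + halves n <= 1.
Proof.
elim: n => [|n [IH0 IH1]]; first by rewrite /dyadic big_ord0 /halves expr0 add0r.
rewrite dyadicS halvesS; have := halves_gt0 n; case: (p n) => /= h0; lra.
Qed.

Lemma bits_agree p n t : 0 <= t < 1 -> agree n (bits t) p ->
  t = dyadic p n + iter n doubling t * halves n.
Proof.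
move=> t01; elim: n => [|n IH] tp; first by rewrite /dyadic big_ord0 /halves expr0 add0r mulr1.
have tn := IH (agree_le (leqnSn n) tp); rewrite dyadicS halvesS [LHS]tn.
have := tp n (ltnSn n); by rewrite /bits => <-; rewrite iterS doublingE; field.
Qed.

Lemma bits_cylinder p n t : 0 <= t < 1 ->
  agree n (bits t) p <-> dyadic p n <= t < dyadic p n + halves n.
Proof.
move=> t01; split.
  move=> /(bits_agree t01) {1 2}->; have /andP[T0 T1] := iter_doubling_itv n t01.
  have h0 := halves_gt0 n; apply/andP; split.
    by rewrite lerDl mulr_ge0// ltW.
  by rewrite ltrD2l gtr_pMl.
elim: n => [_ //|n IH]; rewrite dyadicS halvesS => tn.
have h0 := halves_gt0 n.
have tp : agree n (bits t) p by apply: IH; move: tn; case: (p n) => /= tn; lra.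
have tE := bits_agree t01 tp.
move=> i; rewrite ltnS leq_eqVlt => /orP[/eqP ->|/tp //].
rewrite /bits; move: tn; rewrite {1 2}tE.
set T := iter n doubling t; have -> : (2^-1 <= T) = (halves n / 2 <= T * halves n).
  by rewrite mulrC ler_pM2r.
by case: (p n) => /= tn; apply/idP; first lra; apply/negP; lra.
Qed.

Lemma measurable_bits : measurable_fun setT bits.
Proof.
have mT n : measurable_fun setT (iter n doubling : measurableTypeR R -> R).
  elim: n => [|n IH]; first exact: measurable_id.
  rewrite (_ : iter n.+1 doubling = doubling \o iter n doubling)//.
  apply: measurableT_comp => //.
  apply: measurable_fun_ifT.
  - by apply: measurable_fun_ler => //; exact: measurable_id.
  - by apply: measurable_funB => //; apply: measurable_funM => //; exact: measurable_id.
  - by apply: measurable_funM => //; exact: measurable_id.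
have mbit k b : measurable [set t : measurableTypeR R | bits t k = b].
  have : measurable_fun setT (fun t : measurableTypeR R => 2^-1 <= iter k doubling t).
    by apply: measurable_fun_ler.
  by move=> /(_ measurableT [set b] I); rewrite setTI.
apply: measurable_fun_clopen => P [n Pn].
have -> : bits @^-1` P =
    \bigcup_(w in [set` [seq w <- bitwords n | `[< P (nth false w) >]]])
      [set t | mkseq (bits t) n = w].
  apply/seteqP; split=> [t Pt|t [w] /=].
    exists (mkseq (bits t) n) => //=; rewrite mem_filter mem_bitwords size_mkseq eqxx andbT.
    by apply/asboolP; apply: Pn Pt => i il; rewrite nth_mkseq.
  rewrite mem_filter => /andP[/asboolP Pw _] tw; apply: Pn Pw.
  by rewrite -tw => i il; rewrite nth_mkseq.
apply: fin_bigcup_measurable => // w _.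
have -> : [set t | mkseq (bits t) n = w] = if size w == n then
    \bigcap_(i in `I_n) [set t | bits t i = nth false w i] else set0.
  apply/seteqP; split=> t /=.
    move=> <-; rewrite size_mkseq eqxx => i /= il.
    by rewrite nth_mkseq.
  case: eqP => // sw tw.
  apply: (@eq_from_nth _ false); rewrite size_mkseq// => i il.
  by rewrite nth_mkseq//; exact: tw.
by case: ifP => // _; rewrite bigcap_mkord; apply: bigsetI_measurable => i _; exact: mbit.
Qed.

HB.instance Definition _ := isMeasurableFun.Build _ _ _ _ bits measurable_bits.

Definition unit_lebesgue : set (measurableTypeR R) -> \bar R :=
  mrestr (@lebesgue_measure R) (@measurable_itv R `[0, 1[).
HB.instance Definition _ := Measure.on unit_lebesgue.

Let unit_lebesgueT : unit_lebesgue setT = 1%E.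
Proof.
by rewrite /unit_lebesgue /mrestr setTI lebesgue_measure_itv /= lte_fin ltr01 sube0.
Qed.
HB.instance Definition _ := Measure_isProbability.Build _ _ _ unit_lebesgue unit_lebesgueT.

Definition coin : probability (borel cantor_space) R := distribution unit_lebesgue bits.

Lemma coin_cylinder n (p : point) :
  coin [set x : cantor_space | mkseq x n = mkseq p n] = (halves n)%:E.
Proof.
rewrite /coin /distribution /pushforward /= /unit_lebesgue /mrestr.
rewrite (_ : _ `&` _ = [set` `[dyadic p n, dyadic p n + halves n[]).
  by rewrite lebesgue_measure_itv /= lte_fin ltrDl halves_gt0 -EFinD addrC addKr.
have [d0 d1] := dyadic_itv p n.
apply/seteqP; split=> [t [/= tp]|t /=].
  by rewrite !in_itv /= => /(bits_cylinder p n) <-; apply/agreeP.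
rewrite in_itv /= => tp; have t01 : 0 <= t < 1 by lra.
by split; [apply/agreeP/bits_cylinder|rewrite in_itv].
Qed.

(** * Measures with uniform values on cylinders *)

Section Uniform.
Variable mu : probability (borel cantor_space) R.
Hypothesis mu_cylinder : forall n (p : point),
  mu [set x : cantor_space | mkseq x n = mkseq p n] = (halves n)%:E.

Lemma uniform_count n (P : pred (seq bool)) :
  mu [set x : cantor_space | P (mkseq x n)] = ((count P (bitwords n))%:R * halves n)%:E.
Proof.
have main (s : seq (seq bool)) : uniq s -> {subset s <= bitwords n} ->
    mu [set x : cantor_space | mkseq x n \in s] = ((size s)%:R * halves n)%:E.
  elim: s => [_ _|w s IH /= /andP[ws us] sn].
    by rewrite (_ : mkset _ = set0) ?measure0 ?mul0r//; apply/seteqP; split.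
  rewrite (_ : mkset _ = [set x : cantor_space | mkseq x n = w] `|`
                        [set x : cantor_space | mkseq x n \in s]); last first.
    apply/seteqP; split=> x /=; rewrite inE; first by case/orP => [/eqP|]; [left|right].
    by case=> [->|->]; rewrite ?eqxx ?orbT.
  rewrite measureU.
  - have wn : mkseq (nth false w) n = w.
      have := sn w; rewrite inE eqxx mem_bitwords => /(_ isT)/eqP <-; exact: mkseq_nth.
    have cw := mu_cylinder n (nth false w); rewrite wn in cw.
    apply: etrans (congr2 adde cw (IH us _)) _.
      by move=> v vs; apply: sn; rewrite inE vs orbT.
    by rewrite /= -natr1 mulrDl mul1r addrC.
  - have -> : [set x : cantor_space | mkseq x n = w] = [set x : cantor_space | mkseq x n == w].
      by apply/seteqP; split=> x /= /eqP.
    exact: (measurable_mkseq n (fun v => v == w)).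
  - exact: (measurable_mkseq n (fun v => v \in s)).
  - by apply/seteqP; split=> x //= [->]; rewrite (negbTE ws).
rewrite -size_filter -main ?filter_uniq ?bitwords_uniq//; last first.
  by move=> w; rewrite mem_filter => /andP[].
by congr (mu _); apply/seteqP; split=> x /=; rewrite mem_filter mem_bitwords size_mkseq eqxx andbT.
Qed.

Lemma bernoulli_half (A : set bool) : bernoulli_prob (2^-1 : R) A =
  ((`[< A true >] + `[< A false >])%:R / 2)%:E.
Proof.
rewrite /bernoulli_prob ifT; last by rewrite invr_ge0 ler0n invf_le1// ler1n.
have := @subsetT _ A; rewrite setT_bool => AT.
have E b : `[< [set b] (~~ b) >] = false by apply/asboolF => /=; case: b.
have [->|->|->|->] := subset_set2 AT.
- by rewrite fsbig_set0 !asboolF//= mul0r.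
- by rewrite fsbig_set1 asboolT// (E true) /=; congr EFin; lra.
- by rewrite fsbig_set1 (E false) asboolT//=; congr EFin; lra.
- rewrite -setT_bool bernoulli_pmf1 !asboolT//=; congr EFin; lra.
Qed.

Lemma uniform_bernoulli : is_bernoulli_half mu.
Proof.
move=> n A.
have -> : [set x : cantor_space | forall i, (i < n)%N -> A i (x i)] =
   [set x : cantor_space | [forall i : 'I_n, `[< A i (nth false (mkseq x n) i) >]]].
  apply/seteqP; split=> x /=.
    by move=> Ax; apply/forallP => i; apply/asboolP; rewrite nth_mkseq//; exact: Ax.
  move=> /forallP Ax i il; have /asboolP := Ax (Ordinal il).
  by rewrite nth_mkseq.
rewrite (uniform_count n (fun w => [forall i : 'I_n, `[< A i (nth false w i) >]])).
elim: n A => [|n IH] A.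
  rewrite big_ord0 /=; case: forallP => [_|[]]; last by case.
  by rewrite /halves expr0 mulr1.
rewrite big_ord_recl /= -(IH (fun i => A i.+1)) bernoulli_half cats0 count_cat !count_map.
rewrite -EFinM; congr EFin.
(* Splitting off the first letter factorises the count, matching the first factor of the product. *)
have cE b : count (preim (cons b) (fun w => [forall i : 'I_n.+1, `[< A i (nth false w i) >]]))
   (bitwords n) = (`[< A 0%N b >] *
    count (fun w => [forall i : 'I_n, `[< A i.+1 (nth false w i) >]]) (bitwords n))%N.
  have [A0|A0] := asboolP (A 0%N b).
    rewrite mul1n; apply: eq_count => w /=; apply/forallP/forallP => h i.
      exact: (h (lift ord0 i)).
    by have [j ->|->] := unliftP ord0 i; [exact: h|apply/asboolP].
  rewrite mul0n; apply/eqP; rewrite -leqn0 leqNgt -has_count; apply/hasPn => w _ /=.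
  by apply/negP => /forallP/(_ ord0)/asboolP.
rewrite !cE -mulnDl natrM natrD halvesS; lra.
Qed.

(* A finite-level bijection permutes the words of length [L]. *)
Lemma uniform_permute n L (f f' : point -> point) (C : pred (seq bool)) : (n <= L)%N ->
  (forall x y, agree L x y -> agree L (f x) (f y)) ->
  (forall x y, agree L x y -> agree L (f' x) (f' y)) ->
  (forall x, agree L (f' (f x)) x) ->
  mu [set x : cantor_space | C (mkseq (f x) n)] = mu [set x : cantor_space | C (mkseq x n)].
Proof.
move=> nL fL f'L f'f.
pose phi (w : seq bool) := mkseq (f (nth false w)) L.
have nthL x : agree L (nth false (mkseq x L)) x by move=> i il; rewrite nth_mkseq.
have takeE x : mkseq x n = take n (mkseq x L).
  by rewrite /mkseq -map_take take_iota (minn_idPl nL).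
have -> : [set x : cantor_space | C (mkseq (f x) n)] =
          [set x : cantor_space | (fun w => C (take n (phi w))) (mkseq x L)].
  have E x : mkseq (f x) n = take n (phi (mkseq x L)).
    by rewrite takeE /phi; congr take; apply/agreeP/fL/agree_sym.
  by apply/seteqP; split=> x /=; rewrite E.
have -> : [set x : cantor_space | C (mkseq x n)] =
          [set x : cantor_space | (fun w => C (take n w)) (mkseq x L)].
  by apply/seteqP; split=> x /=; rewrite takeE.
rewrite (uniform_count L (fun w => C (take n (phi w)))).
rewrite (uniform_count L (fun w => C (take n w))); congr (_%:R * _)%:E.
have phiI : {in bitwords L &, injective phi}.
  move=> w w'; rewrite !mem_bitwords => /eqP sw /eqP sw' /agreeP ww'.
  rewrite -(mkseq_nth false w) -(mkseq_nth false w') sw sw'; apply/agreeP.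
  have := f'L _ _ ww'; move=> h.
  exact: agree_trans (agree_sym (f'f _)) (agree_trans h (f'f _)).
have pp : perm_eq (map phi (bitwords L)) (bitwords L).
  apply: uniq_perm; rewrite ?map_inj_in_uniq ?bitwords_uniq//.
  have sub : {subset map phi (bitwords L) <= bitwords L}.
    by move=> w /mapP[v _ ->]; rewrite mem_bitwords size_mkseq.
  have [] := uniq_min_size _ sub; rewrite ?size_map ?map_inj_in_uniq ?bitwords_uniq//.
rewrite -(seq.permP pp (fun w => C (take n w))) count_map.
by apply: eq_count.
Qed.

End Uniform.
End Coin.

(** * Invariant measures *)

Definition modulus (f : cantor_space -> cantor_space) :=
  forall d, exists d', forall x y, agree d' x y -> agree d (f x) (f y).

Lemma clopen_preimage f P : modulus f -> clopen_system P -> clopen_system (f @^-1` P).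
Proof.
move=> mf [n Pn]; have [n' fn] := mf n.
by exists n' => x y /fn /Pn.
Qed.

Lemma measurable_modulus (f : cantor_space -> cantor_space) : modulus f ->
  measurable_fun setT (f : borel cantor_space -> borel cantor_space).
Proof.
move=> mf; apply: measurable_fun_clopen => P cP.
by apply: measurable_clopen; exact: clopen_preimage.
Qed.

Section Invariance.
Variable R : realType.
Implicit Type mu : probability (borel cantor_space) R.

Lemma preserved_borel mu (f : cantor_space -> cantor_space) : modulus f ->
  (forall P, clopen_system P -> mu (f @^-1` P) = mu P) ->
  forall A : set (borel cantor_space), measurable A -> mu (f @^-1` A) = mu A.
Proof.
move=> mf muf A mA.
pose g : {mfun borel cantor_space >-> borel cantor_space} :=
  HB.pack (f : borel cantor_space -> borel cantor_space)
    (isMeasurableFun.Build _ _ _ _ _ (measurable_modulus mf)).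
have := @borel_prob_unique _ (distribution mu g) mu; apply => //.
Qed.

Lemma cantor_negligible mu (A : nat -> set (borel cantor_space)) :
  (forall k, measurable (A k)) -> (forall k, mu (A k) = 0%E) -> \bigcup_k A k <> setT.
Proof.
move=> mA A0 AT.
have nA : mu.-negligible (\bigcup_k A k).
  by apply: negligible_bigcup => k; exists (A k); split; [exact: mA|exact: A0|].
have mU : measurable (\bigcup_k A k) by exact: bigcup_measurable.
have : mu (\bigcup_k A k) = 0%E := measure_negligible mU nA.
rewrite AT probability_setT => /eqP.
by rewrite onee_eq0.
Qed.

Section Tower.
Variables (D : nat -> stage) (M : nat -> nat) (U V : point -> int).
Hypothesis tow : tower D M U V.

Lemma modulus_letter a : modulus (act_letter D a).
Proof. exact: act_letter_cont tow a. Qed.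

Lemma modulus_action g : modulus (action D g).
Proof. exact: action_agree tow g. Qed.

(** On the bits displayed at a stage a generator agrees with [fwd], which permutes the words of full
    depth. This settles clopen sets, uniqueness of measures extends it to Borel sets, and inverses
    and words follow. *)
Lemma balanced_invariant mu : (forall n, balanced (D n)) ->
  (forall n (p : point),
    mu [set x : cantor_space | mkseq x n = mkseq p n] = (halves R n)%:E) ->
  invariant_measure (action D) mu.
Proof.
move=> bal mucyl.
have inv_gen j (A : set (borel cantor_space)) : measurable A ->
    mu (act_letter D (j, true) @^-1` A) = mu A.
  apply: preserved_borel; first exact: modulus_letter.
  move=> P [d Pd]; pose n := maxn j d.
  have jn : (j <= n)%N by rewrite leq_maxl.
  have dM : (d <= M n)%N.
    by have := tower_M tow n; have := tower_depth tow n; rewrite /n; lia.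
  have Mn := tower_M tow n.
  pose C (w : seq bool) := `[< P (nth false w) >].
  have PC x : C (mkseq x d) = `[< P x >].
    apply: asbool_equiv_eq; split; apply: Pd => i il; by rewrite nth_mkseq.
  have jg := tower_gensS tow jn; have okD := tower_ok tow n.+1.
  have -> : act_letter D (j, true) @^-1` P =
      [set x | C (mkseq (fwd (D n.+1) j x) d)].
    apply/seteqP; split=> x /=; rewrite PC => h.
      apply/asboolP; apply: Pd h; apply: agree_le dM _; exact: gen_map_fwd tow _ _ _ jn.
    move: h => /asboolP; apply: Pd; apply: agree_le dM _.
    by apply: agree_sym; exact: gen_map_fwd tow _ _ _ jn.
  have -> : P = [set x | C (mkseq x d)].
    by apply/seteqP; split=> x /=; rewrite PC => /asboolP.
  apply: (uniform_permute mucyl (L := depth (D n.+1)) (f' := bwd (D n.+1) j)); first by lia.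
  - exact: fwd_agree.
  - exact: bwd_agree.
  - by move=> x; have [] := bal n.+1 j jg x.
have mpre a (A : set (borel cantor_space)) : measurable A ->
    measurable (act_letter D a @^-1` A : set (borel cantor_space)).
  by move=> mA; have := measurable_modulus (@modulus_letter a) measurableT mA; rewrite setTI.
have inv_letter a (A : set (borel cantor_space)) : measurable A ->
    mu (act_letter D a @^-1` A) = mu A.
  case: a => j [] mA; first exact: inv_gen.
  rewrite -(inv_gen j _ (mpre (j, false) _ mA)); congr (mu _).
  by apply/seteqP; split=> x /=; rewrite (act_letterK tow (j, true)).
move=> [w rw]; rewrite /action /=; elim: w {rw} => // a w IH A mA.
rewrite -(inv_letter a A mA) -(IH _ (mpre a _ mA)).
by congr (mu _).
Qed.

Lemma invariant_exchange mu j (P Q : pred (seq bool)) L : invariant_measure (action D) mu ->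
  (forall x, P (mkseq x L) = Q (mkseq (gen_map D j x) L)) ->
  mu [set x : cantor_space | P (mkseq x L)] = mu [set x : cantor_space | Q (mkseq x L)].
Proof.
move=> inv PQ; rewrite -(inv (free_gen j) _ (measurable_mkseq L Q)); congr (mu _).
by apply/seteqP; split=> x /=; rewrite PQ.
Qed.

End Tower.

Lemma measure_pred_or mu L (P Q : pred (seq bool)) : (forall w, ~~ (P w && Q w)) ->
  mu [set x : cantor_space | P (mkseq x L) || Q (mkseq x L)] =
  (mu [set x : cantor_space | P (mkseq x L)] + mu [set x : cantor_space | Q (mkseq x L)])%E.
Proof.
move=> PQ; rewrite -measureU; [|exact: measurable_mkseq..|].
  by congr (mu _); apply/seteqP; split=> x /=; [case/orP; [left|right]|case=> ->; rewrite ?orbT].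
apply/seteqP; split=> x //= [Px Qx]; by have := PQ (mkseq x L); rewrite Px Qx.
Qed.

(** Real values make the finite measure identities linear arithmetic. *)
Definition weight mu L (P : pred (seq bool)) : R :=
  fine (mu [set x : cantor_space | P (mkseq x L)]).

Lemma weightE mu L (P : pred (seq bool)) :
  mu [set x : cantor_space | P (mkseq x L)] = (weight mu L P)%:E.
Proof. by rewrite fineK// fin_num_measure//; exact: measurable_mkseq. Qed.

Lemma weight_or mu L (P Q S : pred (seq bool)) : (forall w, ~~ (P w && Q w)) ->
  (forall w, S w = P w || Q w) ->
  weight mu L S = weight mu L P + weight mu L Q.
Proof.
move=> PQ SE; apply: EFin_inj; rewrite EFinD -!weightE -measure_pred_or//.
by congr (mu _); apply/seteqP; split=> x /=; rewrite SE.
Qed.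

Lemma weightT mu L (P : pred (seq bool)) : (forall w, P w) -> weight mu L P = 1.
Proof.
move=> PT; apply: EFin_inj; rewrite -weightE -(probability_setT mu).
by congr (mu _); apply/seteqP; split=> // x _; exact: PT.
Qed.

End Invariance.

Lemma open_mkseq L (P : pred (seq bool)) : open [set x : cantor_space | P (mkseq x L)].
Proof. by apply: (@open_agree _ L) => x y /agreeP /= ->. Qed.

(** * The two actions *)

Lemma bernoulli_action (R : realType) : exists a : F_infty -> cantor_space -> cantor_space,
     [/\ acts_by_homeomorphisms a, topologically_free a, minimal_action a,
         (exists mu : probability (borel cantor_space) R,
            is_bernoulli_half mu /\ invariant_measure a mu) &
         ~ dynamical_comparison R a].
Proof.
have Ld (A : pred (seq bool)) L x y : agree L x y -> A (mkseq x L) = A (mkseq y L).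
  by move/agreeP => ->.
have [|||D [M [D0 tow bal]]] := tower_exists table_ok _ _ _ table_good.
- by move=> x y xy; rewrite (Ld (table_row 0) 3 x y).
- by move=> x y xy; rewrite (Ld (table_col false) 3 x y).
- by [].
exists (action D); split.
- exact: action_homeo tow.
- exact: action_topologically_free tow.
- exact: action_minimal tow.
- exists (coin R); split; first exact: uniform_bernoulli (@coin_cylinder R).
  by apply: (balanced_invariant tow); [exact: bal table_balanced|exact: coin_cylinder].
move=> cmp; apply: (@not_subequivalent D M (fun x => table_row 0 (mkseq x 3))
  (fun x => table_col false (mkseq x 3)) 3); [exact: Ld|exact: tow|].
apply: cmp.
- exact: open_mkseq.
- exact: open_mkseq.
- by exists (fun _ => false).
- by exists (fun _ => false).
move=> mu [_ inv].
have exch j x : (j < 3)%N -> table_src j (mkseq x 3) = table_tgt j (mkseq (gen_map D j x) 3).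
  move=> j3; have := @compat_map _ _ _ _ tow 0%N j x; rewrite D0 => /(_ j3).
  by rewrite /compat D0 => -[].
have W j : (j < 3)%N -> weight mu 3 (table_src j) = weight mu 3 (table_tgt j).
  move=> j3; apply: EFin_inj; rewrite -!weightE.
  by apply: (invariant_exchange inv) => x; exact: exch.
have := W 0%N isT; have := W 1%N isT; have := W 2 isT => /= r2 r1 c1.
pose T : pred (seq bool) := fun w => ~~ (nth false w 0 && nth false w 1).
have Tc : weight mu 3 T = weight mu 3 (table_col false) + weight mu 3 (table_col true).
  by apply: weight_or => w; rewrite /T /table_col;
    case: (nth false w 0) (nth false w 1) (nth false w 2) => [] [] [].
have Tr : weight mu 3 T =
    weight mu 3 (table_row 0) + (weight mu 3 (table_row 1) + weight mu 3 (table_row 2)).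
  rewrite -(@weight_or _ mu 3 (table_row 1) (table_row 2)
    (fun w => table_row 1 w || table_row 2 w))//.
    by apply: weight_or => w; rewrite /T /table_row;
      case: (nth false w 0) (nth false w 1) => [] [].
  by move=> w; rewrite /table_row; case: (nth false w 0) (nth false w 1) => [] [].
(* Some generator moves any given point into the table, so a null table would give a cover of the
   space by countably many null sets. *)
have T0 : 0 < weight mu 3 T.
  rewrite lt0r; apply/andP; split; last exact/fine_ge0/measure_ge0.
  apply/eqP => T0.
  apply: (@cantor_negligible R mu (fun j => action D (free_gen j) @^-1`
      [set x : cantor_space | T (mkseq x 3)])).
  - move=> j; have := measurable_modulus (modulus_action tow (free_gen j)) measurableT
      (measurable_mkseq 3 T); by rewrite setTI.
  - by move=> j; rewrite inv ?weightE ?T0//; exact: measurable_mkseq.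
  apply/seteqP; split=> // x _.
  (* All words beginning with 0 belong to the table. *)
  have [j /= [jx]] := gen_map_hits tow x [:: false].
  by exists j => //=; rewrite /T action_gen /= jx.
(* A row has a third of the positive weight of the table and a column has half of it. *)
rewrite !weightE lte_fin; lra.
Qed.

Lemma paradoxical_action (R : realType) : exists a : F_infty -> cantor_space -> cantor_space,
     [/\ acts_by_homeomorphisms a, topologically_free a, minimal_action a,
         ~ (exists mu : probability (borel cantor_space) R, invariant_measure a mu) &
         ~ dynamical_comparison R a].
Proof.
have Ld (A : pred (seq bool)) L x y : agree L x y -> A (mkseq x L) = A (mkseq y L).
  by move/agreeP => ->.
have [|||D [M [D0 tow _]]] := tower_exists paradox_ok _ _ _ paradox_good.
- by [].
- by move=> x y xy; rewrite (Ld (part 0) 4 x y).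
- by [].
have noinv : ~ (exists mu : probability (borel cantor_space) R, invariant_measure (action D) mu).
  move=> [mu inv].
  have exch j x : (j < 6)%N -> part 0 (mkseq x 4) = part j.+1 (mkseq (gen_map D j x) 4).
    move=> j6; have := @compat_map _ _ _ _ tow 0%N j x; rewrite D0 => /(_ j6).
    by rewrite /compat D0 => -[].
  have W j : (j < 6)%N -> weight mu 4 (part 0) = weight mu 4 (part j.+1).
    move=> j6; apply: EFin_inj; rewrite -!weightE.
    by apply: (invariant_exchange inv) => x; exact: exch.
  have e1 := W 0%N isT; have e2 := W 1%N isT; have e3 : _ = weight mu 4 (part 3) := W 2%N isT.
  have e4 : _ = weight mu 4 (part 4) := W 3%N isT.
  have e5 : _ = weight mu 4 (part 5) := W 4%N isT.
  have e6 : _ = weight mu 4 (part 6) := W 5%N isT.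
  have s4 : 1 = weight mu 4 (part 0) + (weight mu 4 (part 1) +
      (weight mu 4 (part 2) + weight mu 4 (part 3))).
    rewrite -(weightT mu 4 (P := predT))//.
    rewrite -(@weight_or _ mu 4 (part 2) (part 3) (fun w => nth false w 0)).
    - rewrite -(@weight_or _ mu 4 (part 1) _ (fun w => nth false w 0 || nth false w 1)).
      + by apply: weight_or => w /=; case: (nth false w 0) (nth false w 1) => [] [].
      + by move=> w /=; case: (nth false w 0) (nth false w 1) => [] [].
      + by move=> w /=; case: (nth false w 0) (nth false w 1) => [] [].
    - by move=> w /=; case: (nth false w 0) (nth false w 1) => [] [].
    - by move=> w /=; case: (nth false w 0) (nth false w 1) => [] [].
  have s3 : 1 = weight mu 4 (part 4) + (weight mu 4 (part 5) + weight mu 4 (part 6)).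
    rewrite -(weightT mu 4 (P := predT))//.
    rewrite -(@weight_or _ mu 4 (part 5) (part 6) (fun w => nth false w 2)).
    - by apply: weight_or => w /=; case: (nth false w 2).
    - by move=> w /=; case: (nth false w 2) (nth false w 3) => [] [].
    - by move=> w /=; case: (nth false w 2) (nth false w 3) => [] [].
  (* All seven parts have the same weight, which would have to be both a quarter and a third. *)
  by clear -e1 e2 e3 e4 e5 e6 s3 s4; lra.
exists (action D); split => //.
- exact: action_homeo tow.
- exact: action_topologically_free tow.
- exact: action_minimal tow.
move=> cmp; apply: (@not_subequivalent D M predT (fun x => part 0 (mkseq x 4)) 4).
- by [].
- exact: tow.
apply: cmp.
- exact: (open_mkseq 0 predT).
- exact: open_mkseq.
- by exists (fun _ => false).
- by exists (fun _ => false).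
by move=> mu [_ inv]; exfalso; apply: noinv; exists mu.
Qed.

Theorem mainTheorem1 (R : realType) :
  (exists a : F_infty -> cantor_space -> cantor_space,
     [/\ acts_by_homeomorphisms a,
         topologically_free a,
         minimal_action a,
         (exists mu : probability (borel cantor_space) R,
            is_bernoulli_half mu /\ invariant_measure a mu) &
         ~ dynamical_comparison R a]) /\
  (exists a : F_infty -> cantor_space -> cantor_space,
     [/\ acts_by_homeomorphisms a,
         topologically_free a,
         minimal_action a,
         ~ (exists mu : probability (borel cantor_space) R,
              invariant_measure a mu) &
         ~ dynamical_comparison R a]).
Proof. by split; [exact: bernoulli_action|exact: paradoxical_action]. Qed.
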